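(* Let $d\in\mathbb{N}$, let $\theta=(\theta_1,\dots,\theta_d)$ be a vector of positive shape parameters, let $\mu_d(dx):=\pi^{-d/2}e^{-\|x\|_2^2}\,dx$ on $\mathbb{R}^d$, let $\Omega_d$ denote the probability space $(\mathbb{R}^d,\text{Borel},\mu_d)$, and let $K_\theta$ be the integral-Gaussian kernel $$K_\theta(x,y):=\int_{\Omega_d}G_\theta(x,z)G_\theta(z,y)\,\mu_d(dz),\qquad G_\theta(x,y):=\exp\Big(-\sum_{k=1}^d\theta_k^2|x_k-y_k|^2\Big),\qquad x,y\in\mathbb{R}^d.$$ Then $K_\theta$ is the right-sided reproducing kernel of the right-sided reproducing kernel Banach space $\mathcal{B}_{K_\theta}^1(\Omega_d)$ and the two-sided reproducing kernel of the two-sided reproducing kernel Banach space $\mathcal{B}_{K_\theta}^p(\Omega_d)$ for $1<p\le\infty$. Moreover, $\mathcal{B}_{K_\theta}^p(\Omega_d)\subseteq C(\Omega_d)$ for $1\le p\le\infty$.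
   Context: For $\vartheta>0$ and $n\in\mathbb{N}$ (positive integers) put $w_\vartheta:=\frac{2\vartheta^2}{1+(1+4\vartheta^2)^{1/2}+2\vartheta^2}$, $u_\vartheta:=\frac{2\vartheta^2}{1+(1+4\vartheta^2)^{1/2}}$, $\rho_{\vartheta,n}:=(1-w_\vartheta)w_\vartheta^{n-1}$ and $$e_{\vartheta,n}(x):=\Big(\frac{(1+4\vartheta^2)^{1/4}}{2^{n-1}(n-1)!}\Big)^{1/2}e^{-u_\vartheta x^2}H_{n-1}\big((1+4\vartheta^2)^{1/4}x\big),\quad x\in\mathbb{R},$$ with Hermite polynomials $H_{n-1}(x):=(-1)^{n-1}e^{x^2}\frac{d^{n-1}}{dx^{n-1}}e^{-x^2}$. For $n=(n_1,\dots,n_d)\in\mathbb{N}^d$ let $\phi_{\theta,n}(x):=\prod_{k=1}^d\rho_{\theta_k,n_k}e_{\theta_k,n_k}(x_k)$, $x\in\mathbb{R}^d$. One has $K_\theta(x,y)=\sum_{n\in\mathbb{N}^d}\phi_{\theta,n}(x)\phi_{\theta,n}(y)$. For $1\le p<\infty$, $\mathcal{B}_{K_\theta}^p(\Omega_d):=\{f=\sum_{n\in\mathbb{N}^d}a_n\phi_{\theta,n}:(a_n)_{n\in\mathbb{N}^d}\in\ell_p\}$ with norm $(\sum_n|a_n|^p)^{1/p}$; and $\mathcal{B}_{K_\theta}^\infty(\Omega_d):=\{f=\sum_{n\in\mathbb{N}^d}a_n\phi_{\theta,n}:(a_n)\in c_0\}$ with norm $\sup_n|a_n|$, where $c_0$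 denotes the families tending to $0$. $C(\Omega_d)$ is the set of continuous real functions on $\mathbb{R}^d$. Reproducing kernel Banach spaces (here with both domains equal to $\Omega=\Omega_d$): $L_0(\Omega)$ denotes the real-valued measurable functions on $\Omega$ (genuine functions). Let $\mathcal{B}$ be a Banach space consisting of functions in $L_0(\Omega)$ whose continuous dual $\mathcal{B}'$ is isometrically isomorphic to a normed space $\mathcal{F}$ consisting of functions in $L_0(\Omega)$, identified with $\mathcal{B}'$; write $\langle f,G\rangle_{\mathcal{B}}:=G(f)$. $\mathcal{B}$ is right-sided with right-sided reproducing kernel $K$ if (i) $K(x,\cdot)\in\mathcal{F}\cong\mathcal{B}'$ for each $x\in\Omega$ and (ii) $\langle f,K(x,\cdot)\rangle_{\mathcal{B}}=f(x)$ for all $f\in\mathcal{B}$, $x\in\Omega$. It is two-sided with two-sided reproducing kernel $K$ if in addition (iii) $K(\cdot,y)\in\mathcal{B}$ for each $y\in\Omega$ and (iv) $\langle K(\cdot,y),g\rangle_{\mathcal{B}}=g(y)$ for all $g\in\mathcal{F}$, $y\in\Omega$. *)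

(* Defs.v *)
From HB Require Import structures.
From mathcomp Require Import all_boot all_order all_algebra.
From mathcomp Require Import all_classical all_reals all_analysis.
From mathcomp Require Import measurable_realfun.
From mathcomp Require summability.
Set Implicit Arguments.
Unset Strict Implicit.
Unset Printing Implicit Defensive.
Import Order.TTheory GRing.Theory Num.Theory.
Import numFieldNormedType.Exports.
Local Open Scope classical_set_scope.
Local Open Scope ring_scope.

(* R^n is 'rV[R]_n; this is R^n with its Borel sigma-algebra. The norm of
   'rV[R]_n is the sup norm, hence it has the usual topology of R^n. *)
Notation borel_rV R n := (g_sigma_algebraType (@open 'rV[R]_n)).

Section lebesgue_measure_rV.
Variable R : realType.

Lemma borel_rV_open n (U : set 'rV[R]_n) :
  open U -> measurable (U : set (borel_rV R n)).
Proof. exact: sub_sigma_algebra. Qed.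

Definition cons_rV n (p : R * borel_rV R n) : borel_rV R n.+1 :=
  row_mx (p.1%:M : 'rV_1) (p.2 : 'rV_n).

Definition uncons_rV n (v : borel_rV R n.+1) : R * borel_rV R n :=
  ((v : 'rV_(1 + n)) 0 (lshift n 0), rsubmx (v : 'rV_(1 + n))).

Lemma cons_rVK n : cancel (@cons_rV n) (@uncons_rV n).
Proof.
by move=> [x w]; rewrite /cons_rV /uncons_rV row_mxKr row_mxEl mxE eqxx.
Qed.

Lemma cons_rV_lshift n p l :
  (@cons_rV n p : 'rV[R]_n.+1) 0 (@lshift 1 n l) = p.1.
Proof. by apply: etrans (row_mxEl _ _ _ _) _; rewrite mxE !ord1 eqxx. Qed.

Lemma cons_rV_rshift n p l :
  (@cons_rV n p : 'rV[R]_n.+1) 0 (@rshift 1 n l) = (p.2 : 'rV_n) 0 l.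
Proof. exact: etrans (row_mxEr _ _ _ _) _. Qed.

Let rat_near (x e : R) : 0 < e -> exists q : rat, ball (ratr q : R) e x.
Proof.
move=> e0; have /rat_in_itvoo[q] : x - e < x + e.
  by rewrite ltrBlDr -addrA ltrDl addr_gt0.
rewrite in_itv/= => /andP[q1 q2]; exists q.
by rewrite /ball/= ltr_distl ltrBlDr q2 -ltrBlDr q1.
Qed.

Lemma measurable_cons_rV n : measurable_fun setT (@cons_rV n).
Proof.
apply: (@measurability _ _ (R * borel_rV R n)%type (borel_rV R n.+1)
  setT (@cons_rV n) (@open 'rV[R]_n.+1) erefl) => _ [U oU <-].
rewrite setTI; set V := _ @^-1` U.
pose box (t : rat * 'rV[rat]_n * nat) : set (R * borel_rV R n) :=
  ball (ratr t.1.1 : R) t.2.+1%:R^-1 `*`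
  @ball _ 'rV[R]_n (map_mx ratr t.1.2) t.2.+1%:R^-1.
have -> : V = \bigcup_t \bigcup_(_ in [set _ : unit | box t `<=` V]) box t.
  apply/seteqP; split => [[x w] Vxw|p [t _ [_ /= + tp]]]; last exact.
  have /nbhs_ballP[e /= e0 eU] : nbhs (cons_rV (x, w) : 'rV[R]_n.+1) U.
    exact: open_nbhs_nbhs.
  have [k ke] : exists k, (k.+1%:R^-1 : R) < e / 2.
    have := near_infty_natSinv_lt (PosNum (divr_gt0 e0 (ltr0Sn R 1))).
    by case=> k _ /(_ k (leqnn _)) /= ?; exists k.
  have k0 : 0 < (k.+1%:R^-1 : R) by rewrite invr_gt0.
  have [q xq] := rat_near x k0.
  have /(_ _)/cid-/all_sig[v wv] := fun i => rat_near ((w : 'rV_n) 0 i) k0.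
  have xwb : box (q, \row_i v i, k) (x, w).
    by split=> //=; split=> // i j; rewrite !mxE ord1.
  exists (q, \row_i v i, k) => //; exists tt => //= -[x' w'] [/= x'q [_ w'v]].
  have close (a b c : R) :
      ball a k.+1%:R^-1 b -> ball a k.+1%:R^-1 c -> ball b e c.
    move=> ab ac; apply: (@le_ball _ _ _ (k.+1%:R^-1 + k.+1%:R^-1)).
      by rewrite (splitr e) lerD// ltW.
    by apply: ball_triangle ac; exact: ball_sym.
  apply: eU; split=> // i j; rewrite ord1.
  case: (split_ordP (j : 'I_(1 + n))) => l ->.
    by rewrite !cons_rV_lshift; exact: close xq x'q.
  rewrite !cons_rV_rshift; apply: (close (ratr (v l))); first exact: wv.
  by have := w'v 0 l; rewrite !mxE.
apply: countable_bigcupT_measurable => // t.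
have [tV|tV] := pselect (box t `<=` V); last first.
  rewrite (_ : \bigcup_(_ in _) _ = set0)//.
  by rewrite bigcup0// => _ /= /tV.
rewrite (_ : \bigcup_(_ in _) _ = box t); last first.
  by apply/seteqP; split=> [? []//|? ?]; exists tt.
apply: measurableX.
  by apply: open_measurable; exact: ball_open.
by apply: borel_rV_open; exact: ball_open.
Qed.

Lemma continuous_measurable_rV n (f : 'rV[R]_n -> R) :
  continuous f -> measurable_fun setT (f : borel_rV R n -> R).
Proof.
move=> /continuousP cf.
apply: (measurability _ (RGenOInfty.measurableE R)) => _ [_ [a ->] <-].
by rewrite setTI; apply: borel_rV_open; apply: cf; exact: rray_open.
Qed.

Lemma measurable_uncons_rV n : measurable_fun setT (@uncons_rV n).
Proof.
apply/measurable_fun_pairP; split.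
  apply: (@continuous_measurable_rV n.+1 (fun v => v 0 (@lshift 1 n 0))).
  exact: coord_continuous.
apply: (@measurability _ _ (borel_rV R n.+1) (borel_rV R n) setT _
  (@open 'rV[R]_n) erefl) => _ [U oU <-].
rewrite setTI; apply: borel_rV_open.
have /continuousP : continuous (@rsubmx R 1 1 n : 'rV[R]_n.+1 -> 'rV[R]_n).
  move=> v A /nbhs_ballP[e /= e0 eA]; apply/nbhs_ballP.
  exists e => //= w [_ vw].
  by apply: eA; split=> // i j; rewrite !mxE; exact: vw.
exact.
Qed.

Section lebesgue_measure_cons.
Variables (n : nat) (m : {sigma_finite_measure set (borel_rV R n) -> \bar R}).

Definition lebesgue_measure_cons : set (borel_rV R n.+1) -> \bar R :=
  pushforward (@lebesgue_measure R \x m)%E (@cons_rV n).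

Let measurable_preimage_cons A :
  measurable A -> measurable (@cons_rV n @^-1` A).
Proof.
by move=> mA; rewrite -[X in measurable X]setTI; exact: measurable_cons_rV.
Qed.

Let lmc0 : lebesgue_measure_cons set0 = 0%E.
Proof.
by rewrite /lebesgue_measure_cons /pushforward preimage_set0 measure0.
Qed.

Let lmc_ge0 A : (0 <= lebesgue_measure_cons A)%E.
Proof. exact: (measure_ge0 (@lebesgue_measure R \x m)%E). Qed.

Let lmc_sigma_additive : semi_sigma_additive lebesgue_measure_cons.
Proof.
move=> F mF tF mUF; rewrite /lebesgue_measure_cons /pushforward preimage_bigcup.
apply: (measure_semi_sigma_additive (s := (@lebesgue_measure R \x m)%E)).
- by move=> k; exact: measurable_preimage_cons.
- apply/trivIsetP => /= i j _ _ ij; rewrite -preimage_setI.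
  by move/trivIsetP : tF => /(_ _ _ _ _ ij) ->//; rewrite preimage_set0.
- by rewrite -preimage_bigcup; exact: measurable_preimage_cons.
Qed.

HB.instance Definition _ := isMeasure.Build _ _ _
  lebesgue_measure_cons lmc0 lmc_ge0 lmc_sigma_additive.

Let lmc_sigma_finite : sigma_finite setT lebesgue_measure_cons.
Proof.
have /sigma_finiteP[F [FT ndF Foo]] := sigma_finiteT (@lebesgue_measure R).
have /sigma_finiteP[G [GT ndG Goo]] := sigma_finiteT m.
exists (fun k => @uncons_rV n @^-1` (F k `*` G k)).
  apply/esym; rewrite -subTset => v _.
  have [i _ Fi] : (\bigcup_i F i) (uncons_rV v).1 by rewrite -FT.
  have [j _ Gj] : (\bigcup_i G i) (uncons_rV v).2 by rewrite -GT.
  exists (maxn i j) => //; split.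
    by move: Fi; exact/subsetPset/ndF/leq_maxl.
  by move: Gj; exact/subsetPset/ndG/leq_maxr.
move=> k; have [mF Fk] := Foo k; have [mG Gk] := Goo k; split.
  rewrite -[X in measurable X]setTI; apply: measurable_uncons_rV => //.
  exact: measurableX.
rewrite /lebesgue_measure_cons /pushforward -comp_preimage.
rewrite (_ : _ \o _ = id); last by apply/funext => p; exact: cons_rVK.
by rewrite preimage_id product_measure1E// lte_mul_pinfty// ge0_fin_numE.
Qed.

HB.instance Definition _ := Measure_isSigmaFinite.Build _ _ _
  lebesgue_measure_cons lmc_sigma_finite.

End lebesgue_measure_cons.

(* The n-dimensional Lebesgue measure, as an iterated product of the
   one-dimensional one along R * R^n -> R^(n+1). *)
Fixpoint lebesgue_measure_rV n :
    {sigma_finite_measure set (borel_rV R n) -> \bar R} :=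
  match n with
  | 0 => @dirac _ (borel_rV R 0) (0 : 'rV_0) R
  | n'.+1 => lebesgue_measure_cons (lebesgue_measure_rV n')
  end.

End lebesgue_measure_rV.

Arguments lebesgue_measure_rV : clear implicits.

Section gauss_measure_rV.
Variables (R : realType) (d : nat).

Definition gauss_density (z : 'rV[R]_d) : R :=
  pi `^ (- (d%:R / 2)) * expR (- \sum_(k < d) z 0 k ^+ 2).

Definition gauss_measure : set (borel_rV R d) -> \bar R :=
  fun A => (\int[lebesgue_measure_rV R d]_(z in A) (gauss_density z)%:E)%E.

Let gauss_density_ge0 z : 0 <= gauss_density z.
Proof. by rewrite mulr_ge0// ?powR_ge0// expR_ge0. Qed.

Let measurable_gauss_density :
  measurable_fun setT (gauss_density : borel_rV R d -> R).
Proof.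
apply: measurable_funM => //; apply: measurableT_comp.
  exact: measurable_expR.
apply: measurableT_comp => //; apply: measurable_sum => k.
apply: measurable_funX; apply: continuous_measurable_rV.
exact: coord_continuous.
Qed.

Let gauss_measure0 : gauss_measure set0 = 0%E.
Proof. by rewrite /gauss_measure integral_set0. Qed.

Let gauss_measure_ge0 A : (0 <= gauss_measure A)%E.
Proof. by apply: integral_ge0 => z _; rewrite lee_fin. Qed.

Let gauss_measure_sigma_additive : semi_sigma_additive gauss_measure.
Proof.
move=> F mF tF mUF; rewrite /gauss_measure ge0_integral_bigcup//; first last.
- by move=> z _; rewrite lee_fin.
- by apply/measurable_EFinP; exact: measurable_funTS.
by apply: is_cvg_ereal_nneg_natsum_cond => n _ _; exact: gauss_measure_ge0.
Qed.

HB.instance Definition _ := isMeasure.Build _ _ _ gauss_measure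
  gauss_measure0 gauss_measure_ge0 gauss_measure_sigma_additive.

End gauss_measure_rV.
Arguments gauss_measure : clear implicits.

Section gaussian_kernels.
Variables (R : realType) (d : nat) (theta : 'I_d -> R).

Definition gaussian_kernel (x y : 'rV[R]_d) : R :=
  expR (- \sum_(k < d) theta k ^+ 2 * `|x 0 k - y 0 k| ^+ 2).

Definition integral_gaussian_kernel (x y : 'rV[R]_d) : R :=
  \int[gauss_measure R d]_z (gaussian_kernel x z * gaussian_kernel z y).

End gaussian_kernels.

Section eigenfunctions.
Variable R : realType.

Definition hermite (n : nat) (x : R) : R :=
  (-1) ^+ n * expR (x ^+ 2) * derive1n n (fun y => expR (- y ^+ 2)) x.

Definition gk_w (t : R) : R :=
  2 * t ^+ 2 / (1 + Num.sqrt (1 + 4 * t ^+ 2) + 2 * t ^+ 2).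

Definition gk_u (t : R) : R := 2 * t ^+ 2 / (1 + Num.sqrt (1 + 4 * t ^+ 2)).

(* In [gk_rho] and [gk_e] the index n is meant to be positive. *)
Definition gk_rho (t : R) (n : nat) : R := (1 - gk_w t) * gk_w t ^+ n.-1.

Definition gk_e (t : R) (n : nat) (x : R) : R :=
  Num.sqrt ((1 + 4 * t ^+ 2) `^ 4^-1 / (2 ^+ n.-1 * (n.-1)`!%:R)) *
  expR (- (gk_u t * x ^+ 2)) * hermite n.-1 ((1 + 4 * t ^+ 2) `^ 4^-1 * x).

(* The multi-indices, whose entries are positive integers, are represented by
   m : {ffun 'I_d -> nat} with k-th entry (m k).+1. *)
Definition gk_phi d (theta : 'I_d -> R) (m : {ffun 'I_d -> nat})
    (x : 'rV[R]_d) : R :=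
  \prod_(k < d) (gk_rho (theta k) (m k).+1 * gk_e (theta k) (m k).+1 (x 0 k)).

End eigenfunctions.

Section sequence_spaces.
Variables (R : realType) (I : choiceType).
Implicit Types (p : \bar R) (a : I -> R).

(* l_p for finite p, and c_0 (not l_oo) for p = +oo *)
Definition in_lp p a : Prop :=
  match p with
  | r%:E => (\esum_(n in [set: I]) (`|a n| `^ r)%:E < +oo)%E
  | +oo%E => forall e : R, 0 < e -> finite_set [set n | e <= `|a n|]
  | -oo%E => False
  end.

Definition lp_norm p a : R :=
  match p with
  | r%:E => fine (\esum_(n in [set: I]) (`|a n| `^ r)%:E)%E `^ r^-1
  | +oo%E => sup [set `|a n| | n in [set: I]]
  | -oo%E => 0
  end.

(* unconditional convergence: the finite sums converge along the finite
   subsets of I ordered by inclusion *)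
Definition has_sum a (s : R) : Prop :=
  summability.partial_sum a @ summability.totally --> s.

End sequence_spaces.

Section function_spaces.
Context (dT : measure_display) (T : measurableType dT) (R : realType).

(* A normed space consisting of measurable functions on T: [fun_of] sends an
   element of V to the function that it is. *)
Record fun_space (V : normedModType R) := FunSpace {
  fun_of : {linear V -> (T -> R)} ;
  fun_of_inj : injective fun_of ;
  fun_of_meas : forall f, measurable_fun setT (fun_of f) }.

Definition dual_norm (V : normedModType R) (G : V -> R) : R :=
  sup [set `|G f| | f in [set f : V | `|f| <= 1]].

(* J is an isometric isomorphism of F onto the continuous dual of B, that is
   <f, g>_B = J g f. It is injective since it preserves the norm. *)
Definition dual_isometry (B F : normedModType R)
    (J : {linear F -> (B -> R)}) : Prop :=
  [/\ forall g, scalar (J g) /\ continuous (J g),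
      forall g, dual_norm (J g) = `|g| &
      forall G : B -> R, scalar G -> continuous G -> exists g, J g = G].

Section reproducing.
Variables (B F : normedModType R) (b : fun_space B) (f : fun_space F).
Variables (J : {linear F -> (B -> R)}) (K : T -> T -> R).

Definition right_reproducing : Prop :=
  (forall x, exists k, fun_of f k = K x) /\
  (forall x k, fun_of f k = K x -> forall h, J k h = fun_of b h x).

Definition left_reproducing : Prop :=
  (forall y, exists k, fun_of b k = K ^~ y) /\
  (forall y k, fun_of b k = K ^~ y -> forall g, J g k = fun_of f g y).

End reproducing.

Definition right_sided_RKBS (B : completeNormedModType R) (b : fun_space B)
    (K : T -> T -> R) : Prop :=
  exists (F : normedModType R) (f : fun_space F) (J : {linear F -> (B -> R)}),
    dual_isometry J /\ right_reproducing b f J K.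

Definition two_sided_RKBS (B : completeNormedModType R) (b : fun_space B)
    (K : T -> T -> R) : Prop :=
  exists (F : normedModType R) (f : fun_space F) (J : {linear F -> (B -> R)}),
    [/\ dual_isometry J, right_reproducing b f J K & left_reproducing b f J K].

End function_spaces.

Section Bp_spaces.
Variables (R : realType) (d : nat) (theta : 'I_d -> R).

Definition gk_expansion (a : {ffun 'I_d -> nat} -> R) (f : 'rV[R]_d -> R) :=
  forall x, has_sum (fun m => a m * gk_phi theta m x) (f x).

Definition Bp_set (p : \bar R) : set ('rV[R]_d -> R) :=
  [set f | exists2 a, in_lp p a & gk_expansion a f].

(* The Banach function space B (with its functions given by b) is the space
   B^p of the kernel; in particular the norm of a function does not depend on
   the choice of its coefficients. *)
Definition is_Bp (p : \bar R) (B : completeNormedModType R)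
    (b : fun_space (borel_rV R d) B) : Prop :=
  range (fun_of b) = Bp_set p /\
  forall v a, in_lp p a -> gk_expansion a (fun_of b v) -> `|v| = lp_norm p a.

End Bp_spaces.

(* Main.v *)
(* K(x,y) = sum_m phi_m(x) phi_m(y) is obtained coordinate by coordinate: K is a product
   of one-dimensional Gaussian integrals, and the one-dimensional sums are evaluated by
   Mehler's formula, both sides of which solve the same linear first-order ODE in q.

   B^p is l_p (c_0 for p = oo) transported by a |-> sum_m a_m phi_m, and its dual consists
   of the functions y |-> G (K(.,y)), where G ranges over the continuous functionals on
   B^p; thus no description of the dual of l_p as a sequence space is needed. As K(.,y)
   corresponds to the summable family (phi_m(y))_m, all evaluations then reproduce, for
   p = 1 as well. What has to be shown is that sum_m a_m phi_m = 0 with bounded a forces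
   a = 0. For fixed values of the other coordinates this sum is sum_m c_m H_(m_k)(z)
   with rapidly decaying c; differentiating it termwise, the Hermite equation shows that
   it still vanishes when c_m is multiplied by m_k, hence by m_k^j, hence (power series)
   by exp(- l t m_k) for all l. Letting l tend to infinity isolates the terms with a
   given m_k, and treating the coordinates in turn leaves a single term. *)
Require Import Defs.
From HB Require Import structures.
From mathcomp Require Import all_boot all_order all_algebra finmap.
From mathcomp Require Import all_classical all_reals all_analysis.
From mathcomp Require Import measurable_realfun.
From mathcomp Require Import ring lra zify.
Import Order.TTheory GRing.Theory Num.Theory.
Import numFieldNormedType.Exports.
Set Implicit Arguments.
Unset Strict Implicit.
Unset Printing Implicit Defensive.
Local Open Scope classical_set_scope.
Local Open Scope ring_scope.

(** * Unconditional sums of families *)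

#[local] Existing Instance summability.totally_filter.

Section summation.
Variables (R : realType) (I : choiceType).
Implicit Types (a b : I -> R) (A : {fset I}) (s t M e : R).

(** Freeness of the phi_m is used twice: for the coefficients of an element of B^p, and for the
    values G(delta_m) of a continuous functional on the unit families delta_m, which for p = 1 are
    no better than bounded. This is why it is proved for bounded coefficients. That the dual
    functions are expansions with coefficients G(delta_m) rests on the density of the finitely
    supported families, which c_0 has and l_oo lacks. All exchanges of limits and sums rest on one
    margin. Locally uniformly in x, |H_n(x)| is at most C q^n sqrt(2^n n!) for every q > 1, while
    phi_m carries w^n / sqrt(2^n n!) with a fixed w < 1; so a factor q^n for some q > 1 is to spare.
    It pays for powers of n and for termwise derivatives. It also limits the multiplier exp(- t n):
    the partial sums of its power series are dominated only by exp(t n), so only small t are within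
    reach. Since multiplying by exp(- t n) does not consume the margin, the step can be repeated,
    which yields exp(- l t n) for all l. *)

Definition asum_le a M := forall A, \sum_(i <- A) `|a i| <= M.
Definition asummable a := exists M, asum_le a M.

Lemma partial_sumE a A : summability.partial_sum a A = \sum_(i <- A) a i.
Proof. by rewrite /summability.partial_sum big_seq_fsetE. Qed.

Lemma has_sumP a s : has_sum a s <-> forall e, 0 < e ->
  exists A0, forall A, (A0 `<=` A)%fset -> `|s - \sum_(i <- A) a i| <= e.
Proof.
split=> [/cvgrPdist_le h e e0|h].
  have [A0 _ hA0] := h _ e0; exists A0 => A A0A.
  by have := hA0 A A0A; rewrite partial_sumE.
apply/cvgrPdist_le => e e0; have [A0 hA0] := h _ e0; exists A0 => // A /= A0A.
by rewrite partial_sumE; exact: hA0.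
Qed.

Lemma has_sum_uniq a s t : has_sum a s -> has_sum a t -> s = t.
Proof.
by move=> sa ta; apply: (cvg_unique (@norm_hausdorff _ R^o) sa ta).
Qed.

Lemma eq_has_sum a b s : a =1 b -> has_sum a s -> has_sum b s.
Proof. by move=> /funext ->. Qed.

Lemma has_sumD a b s t :
  has_sum a s -> has_sum b t -> has_sum (fun i => a i + b i) (s + t).
Proof.
move=> sa tb; rewrite /has_sum.
rewrite (_ : summability.partial_sum _ =
  summability.partial_sum a \+ summability.partial_sum b); first exact: cvgD.
by apply/funext => A /=; rewrite !partial_sumE big_split.
Qed.

Lemma has_sumZ k a s : has_sum a s -> has_sum (fun i => k * a i) (k * s).
Proof.
move=> sa; rewrite /has_sum.
rewrite (_ : summability.partial_sum _ =
  (fun A => k * summability.partial_sum a A)); first exact: cvgMr.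
by apply/funext => A /=; rewrite !partial_sumE mulr_sumr.
Qed.

Lemma has_sumB a b s t :
  has_sum a s -> has_sum b t -> has_sum (fun i => a i - b i) (s - t).
Proof.
move=> sa tb; have := has_sumD sa (@has_sumZ (-1) _ _ tb); rewrite mulN1r.
by apply: eq_has_sum => i; rewrite mulN1r.
Qed.

Lemma has_sum_fset A a : (forall i, i \notin A -> a i = 0) ->
  has_sum a (\sum_(i <- A) a i).
Proof.
move=> a0; apply/has_sumP => e e0; exists A => B AB.
by rewrite -(big_fset_incl _ AB) ?subrr ?normr0 ?ltW// => i _ /a0.
Qed.

Lemma has_sum0 : has_sum (fun _ : I => 0 : R) 0.
Proof.
by have := @has_sum_fset fset0 (fun=> 0) (fun _ _ => erefl); rewrite big_seq_fset0.
Qed.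

Lemma sum_fsetU (A B : {fset I}) (F : I -> R) : [disjoint A & B]%fset ->
  \sum_(i <- (A `|` B)%fset) F i = \sum_(i <- A) F i + \sum_(i <- B) F i.
Proof.
move=> dAB; rewrite (big_fsetID _ [in A]) /=; congr (_ + _); apply: congr_big => //.
  congr enum_fset; apply/fsetP => i; rewrite !inE /=.
  by case: (i \in A) => //=; rewrite andbF.
congr enum_fset; apply/fsetP => i; rewrite !inE /=.
have [iA|] //= := boolP (i \in A).
  by rewrite (negbTE (fdisjointP dAB _ iA)).
by rewrite andbT.
Qed.

Lemma sum_fset_sub A B (F : I -> R) : (A `<=` B)%fset ->
  \sum_(i <- B) F i = \sum_(i <- A) F i + \sum_(i <- (B `\` A)%fset) F i.
Proof.
move=> AB; rewrite -sum_fsetU.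
  by rewrite fsetUDl fsetDv fsetD0 (fsetUidPr _ _ AB).
by apply/fdisjointP => i iA; rewrite inE iA.
Qed.

Lemma ler_sum_fset A B (F : I -> R) : (forall i, 0 <= F i) -> (A `<=` B)%fset ->
  \sum_(i <- A) F i <= \sum_(i <- B) F i.
Proof. by move=> F0 AB; rewrite (sum_fset_sub _ AB) lerDl sumr_ge0. Qed.

Lemma asum_le_dom a b M : (forall i, `|a i| <= `|b i|) ->
  asum_le b M -> asum_le a M.
Proof. by move=> ab bM A; apply: le_trans (bM A); exact: ler_sum. Qed.

Lemma asummable_dom a b : (forall i, `|a i| <= `|b i|) ->
  asummable b -> asummable a.
Proof. by move=> ab [M bM]; exists M; exact: asum_le_dom bM. Qed.

Lemma asummableZ k a : asummable a -> asummable (fun i => k * a i).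
Proof.
move=> [M aM]; exists (`|k| * M) => A.
by under eq_bigr do rewrite normrM; rewrite -mulr_sumr ler_wpM2l.
Qed.

Lemma asummable_mull c C a : (forall i, `|c i| <= C) -> asummable a ->
  asummable (fun i => c i * a i).
Proof.
move=> cC /(asummableZ C); apply: asummable_dom => i.
by rewrite !normrM ler_wpM2r// (le_trans (cC i))// ler_norm.
Qed.

Lemma asum_le_ge0 a M : asum_le a M -> 0 <= M.
Proof. by move=> /(_ fset0); rewrite big_seq_fset0. Qed.

Lemma asum_le_term a M i : asum_le a M -> `|a i| <= M.
Proof. by move=> /(_ [fset i]%fset); rewrite big_seq_fset1. Qed.

(** [A0] is chosen with absolute sum within [e] of the supremum over all finite sets; a disjoint set
    cannot add more than [e]. *)
Lemma asummable_tail b : asummable b -> forall e, 0 < e ->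
  exists A0, forall A, [disjoint A0 & A]%fset -> \sum_(i <- A) `|b i| <= e.
Proof.
move=> [M bM] e e0; pose S := [set \sum_(i <- A) `|b i| | A in @setT {fset I}].
have supS : has_sup S.
  split; first by exists (\sum_(i <- fset0 : {fset I}) `|b i|); exists fset0.
  by exists M => _ [A _ <-]; exact: bM.
have [_ [A0 _ <-] A0e] := sup_adherent e0 supS; exists A0 => A dA.
have : \sum_(i <- (A0 `|` A)%fset) `|b i| <= sup S.
  by apply: sup_upper_bound => //; exists (A0 `|` A)%fset.
by rewrite (sum_fsetU _ dA); lra.
Qed.

Lemma asummable_has_sum a : asummable a -> exists s, has_sum a s.
Proof.
move=> /asummable_tail ta.
suff : cvg (summability.partial_sum a @ summability.totally).
  by move=> ?; exists (lim (summability.partial_sum a @ summability.totally)).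
apply/cauchy_cvgP/cauchy_exP => e e0.
have [A0 hA0] := ta (e / 2) (divr_gt0 e0 (ltr0Sn _ _)).
exists (\sum_(i <- A0) a i); exists A0 => // A /= A0A.
rewrite /ball /= partial_sumE (sum_fset_sub _ A0A) opprD addNKr normrN.
apply: le_lt_trans (ler_norm_sum _ _ _) _.
apply: le_lt_trans (hA0 _ _) _; last by lra.
by apply/fdisjointP => i iA0; rewrite inE iA0.
Qed.

Lemma has_sum_norm_le a s M : has_sum a s -> asum_le a M -> `|s| <= M.
Proof.
move=> /has_sumP sa aM; apply/ler_addgt0Pr => e e0.
have [A0 /(_ _ (fsubset_refl _))] := sa _ e0.
move=> h; rewrite addrC -[s](subrK (\sum_(i <- A0) a i)).
apply: le_trans (ler_normD _ _) _; apply: lerD => //.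
exact: le_trans (ler_norm_sum _ _ _) (aM _).
Qed.

Lemma has_sum_partial_le a s A0 e : has_sum a s ->
  (forall A, [disjoint A0 & A]%fset -> \sum_(i <- A) `|a i| <= e) ->
  `|s - \sum_(i <- A0) a i| <= e.
Proof.
move=> /has_sumP sa h; apply/ler_addgt0Pr => d d0.
have [A1 /(_ _ (fsubsetUr A0 A1))] := sa _ d0.
rewrite (sum_fset_sub _ (fsubsetUl A0 A1)) => sd.
have := h ((A0 `|` A1) `\` A0)%fset.
have dA : [disjoint A0 & (A0 `|` A1) `\` A0]%fset.
  by apply/fdisjointP => i iA0; rewrite inE iA0.
move=> /(_ dA) /(le_trans (ler_norm_sum _ _ _)) h1.
move: sd h1; move: (\sum_(i <- A0) a i) => x.
move: (\sum_(i <- _) a i) => y sd h1.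
rewrite (_ : s - x = y + (s - (x + y))); last by ring.
by rewrite (le_trans (ler_normD _ _))// lerD.
Qed.

(** Dominated convergence for sums. A finite set outside of which [b] has small sum serves all [j]
    at once, so only finitely many terms have to converge. The filter is arbitrary because
    sequences, difference quotients and neighbourhoods of a point all occur below. *)
Lemma tannery (T : Type) (F : set_system T) {FF : ProperFilter F}
    (a : T -> I -> R) (al b : I -> R) (s : T -> R) (sl : R) :
  asummable b ->
  (\forall j \near F, forall i, `|a j i| <= b i) ->
  (forall i, a j i @[j --> F] --> al i) ->
  (\forall j \near F, has_sum (a j) (s j)) ->
  has_sum al sl ->
  s @ F --> sl.
Proof.
move=> sb ab aal sa sal.
have b0 i : 0 <= b i.
  have [j hj] : exists j, forall i, `|a j i| <= b i by apply: filter_ex ab.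
  exact: le_trans (hj i).
have alb i : `|al i| <= b i.
  apply: cvgr_to_le (cvg_norm (aal i)) _.
  by apply: filterS ab => j; exact.
apply/cvgrPdist_le => e e0.
have e3 : 0 < e / 3 by lra.
have [A0 hA0] := asummable_tail sb e3.
have fin : (fun j => \sum_(i <- A0) a j i) @ F --> \sum_(i <- A0) al i.
  by apply: cvg_big => [|i _]; [exact: add_continuous|exact: aal].
move/cvgrPdist_le : fin => /(_ _ e3) fin.
have tl (c : I -> R) : (forall i, `|c i| <= b i) ->
    forall A, [disjoint A0 & A]%fset -> \sum_(i <- A) `|c i| <= e / 3.
  move=> cb A /hA0; apply: le_trans; apply: ler_sum => i _.
  by rewrite (le_trans (cb i))// ler_norm.
have h1 := has_sum_partial_le sal (tl _ alb).
near=> j.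
have h2 : `|s j - \sum_(i <- A0) a j i| <= e / 3.
  apply: has_sum_partial_le; first by near: j.
  by apply: tl; near: j.
have h3 : `|\sum_(i <- A0) al i - \sum_(i <- A0) a j i| <= e / 3.
  by near: j.
move: h1 h2 h3.
move: (\sum_(i <- A0) al i) (\sum_(i <- A0) a j i) => x y.
by rewrite !ler_norml => /andP[? ?] /andP[? ?] /andP[? ?]; apply/andP; split; lra.
Unshelve. all: by end_near. Qed.

Lemma has_sum_subseq (E : nat -> {fset I}) a s :
  (forall A, \forall n \near \oo, (A `<=` E n)%fset) -> has_sum a s ->
  (fun n => \sum_(i <- E n) a i) @ \oo --> s.
Proof.
move=> Einf sa.
rewrite (_ : (fun n => _) = summability.partial_sum a \o E); last first.
  by apply/funext => n /=; rewrite partial_sumE.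
apply: cvg_comp sa => A [A0 _ hA0]; have := Einf A0.
by apply: filterS => n; exact: hA0.
Qed.
End summation.

(** * Product families of multi-indices, summed along cubes *)

Section box_sums.
Variables (R : realType) (d : nat).
Implicit Types (g : 'I_d -> nat -> R).

Definition ffun_val N (f : {ffun 'I_d -> 'I_N}) : {ffun 'I_d -> nat} :=
  [ffun j => val (f j)].

Definition box N : {fset {ffun 'I_d -> nat}} :=
  [fset ffun_val f | f in {: {ffun 'I_d -> 'I_N}}]%fset.

Lemma big_box g N : \sum_(m <- box N) \prod_(j < d) g j (m j) =
  \prod_(j < d) \sum_(n < N) g j n.
Proof.
rewrite bigA_distr_bigA/= big_imfset/=; last first.
  move=> f1 f2 _ _ /ffunP f12; apply/ffunP => j; apply: val_inj.
  by have := f12 j; rewrite !ffunE.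
rewrite big_enum/=; apply: eq_bigr => f _.
by apply: eq_bigr => j _; rewrite ffunE.
Qed.

Lemma sub_box (A : {fset {ffun 'I_d -> nat}}) :
  \forall N \near \oo, (A `<=` box N)%fset.
Proof.
pose M := (\max_(m <- A) \max_(j < d) m j)%N.
exists M.+1 => // N /= MN; apply/fsubsetP => m mA.
have mN j : (m j < N)%N.
  apply: leq_trans MN; rewrite ltnS; apply: leq_trans (leq_bigmax_seq _ mA _) => //.
  exact: (leq_bigmax j).
apply/imfsetP; exists [ffun j => Ordinal (mN j)] => //.
by apply/ffunP => j; rewrite !ffunE.
Qed.

Lemma asummable_prod g (M : 'I_d -> R) :
  (forall j N, \sum_(n < N) `|g j n| <= M j) ->
  asummable (fun m : {ffun 'I_d -> nat} => \prod_(j < d) g j (m j)).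
Proof.
move=> gM; exists (\prod_(j < d) M j) => A.
have [N _ /(_ _ (leqnn _))/= AN] := sub_box A.
apply: le_trans (ler_sum_fset _ AN) _ => // .
rewrite (eq_bigr (fun m : {ffun 'I_d -> nat} =>
  \prod_(j < d) `|g j (m j)|)); last first.
  by move=> m _; exact: normr_prod.
rewrite (big_box (fun j n => `|g j n|)); apply: ler_prod => j _.
by rewrite gM andbT sumr_ge0.
Qed.

(** Over a cube the sum of products factors into a product of one-dimensional partial sums. The
    cubes are cofinal, so once absolute summability gives existence of the sum, its value can be
    read off along them. *)
Lemma has_sum_prod g (M s : 'I_d -> R) :
  (forall j N, \sum_(n < N) `|g j n| <= M j) ->
  (forall j, (fun N => \sum_(n < N) g j n) @ \oo --> s j) ->
  has_sum (fun m : {ffun 'I_d -> nat} => \prod_(j < d) g j (m j))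
    (\prod_(j < d) s j).
Proof.
move=> /asummable_prod/asummable_has_sum[t gt] gs.
suff -> : \prod_(j < d) s j = t by [].
have := has_sum_subseq sub_box gt; under eq_fun do rewrite big_box.
have : (fun N => \prod_(j < d) \sum_(n < N) g j n) @ \oo -->
    \prod_(j < d) s j.
  by apply: cvg_big => [|j _]; [exact: mul_continuous|exact: gs].
exact: (cvg_unique (@norm_hausdorff _ R^o)).
Qed.

Lemma sum_geometric_le (g : nat -> R) C r : 0 <= r < 1 -> 0 <= C ->
  (forall n, `|g n| <= C * r ^+ n) ->
  forall N, \sum_(n < N) `|g n| <= C / (1 - r).
Proof.
move=> /andP[r0 r1] C0 gC N.
apply: (@le_trans _ _ (\sum_(n < N) C * r ^+ n)).
  by apply: ler_sum => n _; exact: gC.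
rewrite -mulr_sumr ler_wpM2l// -[leRHS]mul1r ler_pdivlMr ?subr_gt0//.
rewrite mulrC -opprB mulNr -subrX1 opprB gerBl exprn_ge0//.
Qed.
End box_sums.

(** * The spaces l_p and c_0 *)

Section lp_bounds.
Variables (R : realType) (I : choiceType).
Implicit Types (p : \bar R) (a b : I -> R) (A : {fset I}) (M e r : R).

(* The ball of radius M of l_p, and of l_oo (not of c_0) for p = +oo. *)
Definition lp_le p a M : Prop := 0 <= M /\
  match p with
  | r%:E => forall A, \sum_(i <- A) `|a i| `^ r <= M `^ r
  | +oo%E => forall i, `|a i| <= M
  | -oo%E => False
  end.

Lemma esum_leP (f : I -> R) M : (forall i, 0 <= f i) ->
  (\esum_(i in [set: I]) (f i)%:E <= M%:E)%E <->
  (forall A, \sum_(i <- A) f i <= M).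
Proof.
move=> f0; split=> [h A|h].
  rewrite -lee_fin; apply: le_trans h.
  apply: esum_ge; exists [set` A]; first by split.
  by rewrite fsbig_finite//= set_fsetK -sumEFin.
apply: ge_ereal_sup => _ [A [finA _] <-].
by rewrite fsbig_finite//= sumEFin lee_fin.
Qed.

Lemma lp_le_norm p a : (1 <= p)%E -> in_lp p a -> lp_le p a (lp_norm p a).
Proof.
case: p => [r| |]// r1.
  rewrite lee_fin in r1; have r0 : 0 < r by apply: lt_le_trans r1.
  rewrite /in_lp /lp_le /lp_norm => h; split; first exact: powR_ge0.
  have h0 i : 0 <= `|a i| `^ r by exact: powR_ge0.
  have fS : (\esum_(i in [set: I]) (`|a i| `^ r)%:E)%E \is a fin_num.
    by rewrite ge0_fin_numE// esum_ge0// => i _; rewrite lee_fin.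
  rewrite -powRrM mulVf ?gt_eqF// powRr1; last first.
    by rewrite fine_ge0// esum_ge0// => i _; rewrite lee_fin.
  by apply/(esum_leP _ h0); rewrite fineK.
rewrite /in_lp /lp_le /lp_norm => h.
suff sa i : `|a i| <= sup [set `|a n| | n in [set: I]].
  (* An empty index set needs its own case: the supremum of the empty set is 0 by convention. *)
  split=> //; have [[i _]|nI] := pselect (exists i : I, True).
    by apply: le_trans (sa i).
  by rewrite sup_out// => -[[_ [i _ _]] _]; apply: nI; exists i.
apply: ub_le_sup; last by exists i.
(* Finitely many terms reach 1, and their sum bounds the family up to 1. *)
have fin : finite_set [set n | 1 <= `|a n|] by exact: h.
exists (1 + \sum_(i <- fset_set [set n | 1 <= `|a n|]) `|a i|) => _ [j _ <-].
have [a1|/ltW a1] := leP 1 `|a j|; last first.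
  by apply: le_trans a1 _; rewrite lerDl sumr_ge0.
have jA : j \in fset_set [set n | 1 <= `|a n|].
  by rewrite in_fset_set// inE.
rewrite (big_fsetD1 _ jA)/= addrCA lerDl addr_ge0// sumr_ge0//.
Qed.

Lemma norm_le_lp p a M : (1 <= p)%E -> lp_le p a M -> lp_norm p a <= M.
Proof.
case: p => [r| |]// r1 [M0 h].
  rewrite lee_fin in r1; have r0 : 0 < r by apply: lt_le_trans r1.
  have h0 i : 0 <= `|a i| `^ r by exact: powR_ge0.
  rewrite /lp_norm; move/(esum_leP _ h0) : h => h.
  have e0 : (0 <= \esum_(i in [set: I]) (`|a i| `^ r)%:E)%E.
    by rewrite esum_ge0// => i _; rewrite lee_fin.
  have -> : M = (M `^ r) `^ r^-1 by rewrite -powRrM mulfV ?gt_eqF// powRr1.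
  apply: ge0_ler_powR; rewrite ?invr_ge0 ?nnegrE ?powR_ge0 ?(ltW r0) ?fine_ge0//.
  by rewrite -lee_fin fineK// ge0_fin_numE//; apply: le_lt_trans h (ltry _).
rewrite /lp_norm; have [[i _]|nI] := pselect (exists i : I, True).
  by apply: ge_sup => [|_ [j _ <-]]; [exists `|a i|; exists i|exact: h].
by rewrite sup_out// => -[[_ [i _ _]] _]; apply: nI; exists i.
Qed.

Lemma in_lp_le r a M : 1 <= r -> lp_le r%:E a M -> in_lp r%:E a.
Proof.
move=> r1 [M0 h]; have h0 i : 0 <= `|a i| `^ r by exact: powR_ge0.
by move/(esum_leP _ h0) : h => /le_lt_trans; apply; exact: ltry.
Qed.

Lemma lp_le_term p a M i : (1 <= p)%E -> lp_le p a M -> `|a i| <= M.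
Proof.
case: p => [r| |]// r1 [M0 h]; last exact: h.
rewrite lee_fin in r1; have r0 : 0 < r by apply: lt_le_trans r1.
have := h [fset i]%fset; rewrite big_seq_fset1.
rewrite leNgt; apply: contraNle => Ma.
by apply: gt0_ltr_powR; rewrite ?nnegrE.
Qed.

(** Minkowski's inequality by convexity of the r-th power: (|a| + |b|) / (M + M') is the convex
    combination of |a| / M and |b| / M' with weights M / (M + M') and M' / (M + M'). The divisions
    force the separate cases M = 0 and M' = 0. *)
Lemma lp_leD p a b M M' : (1 <= p)%E -> lp_le p a M -> lp_le p b M' ->
  lp_le p (fun i => a i + b i) (M + M').
Proof.
case: p => [r| |]// r1 [M0 ha] [M'0 hb]; split; rewrite ?addr_ge0//; last first.
  by move=> i; rewrite (le_trans (ler_normD _ _))// lerD.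
rewrite lee_fin in r1; have r0 : 0 < r by apply: lt_le_trans r1.
move=> A.
have [M_eq0|M_neq0] := eqVneq M 0.
  have a0 i : a i = 0.
    by apply/eqP; rewrite -normr_le0 -M_eq0; apply: (@lp_le_term r%:E).
  by under eq_bigr do rewrite a0 add0r; rewrite M_eq0 add0r.
have [M'_eq0|M'_neq0] := eqVneq M' 0.
  have b0 i : b i = 0.
    by apply/eqP; rewrite -normr_le0 -M'_eq0; apply: (@lp_le_term r%:E).
  by under eq_bigr do rewrite b0 addr0; rewrite M'_eq0 addr0.
have {M_neq0}M0 : 0 < M by rewrite lt_def M_neq0.
have {M'_neq0}M'0 : 0 < M' by rewrite lt_def M'_neq0.
set S := M + M'; have S0 : 0 < S by rewrite addr_gt0.
have t0 : 0 <= M / S by rewrite divr_ge0 ?ltW.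
have t1 : M / S <= 1 by rewrite ler_pdivrMr// mul1r /S lerDl ltW.
have onemt : 1 - M / S = M' / S by rewrite /S; field; rewrite gt_eqF.
have conv i : `|a i + b i| `^ r <=
    S `^ r * (M / S * (`|a i| / M) `^ r + M' / S * (`|b i| / M') `^ r).
  have -> : `|a i + b i| `^ r = S `^ r * (`|a i + b i| / S) `^ r.
    by rewrite -powRM ?divr_ge0 ?(ltW S0)// mulrC divfK// gt_eqF.
  rewrite ler_wpM2l ?powR_ge0//.
  apply: (@le_trans _ _ ((M / S * (`|a i| / M) + M' / S * (`|b i| / M')) `^ r)).
    apply: ge0_ler_powR; rewrite ?nnegrE ?(ltW r0) ?divr_ge0 ?(ltW S0)//.
      by rewrite addr_ge0// mulr_ge0// divr_ge0// ltW.
    have -> : M / S * (`|a i| / M) + M' / S * (`|b i| / M') =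
        (`|a i| + `|b i|) / S.
      by field; rewrite !gt_eqF.
    by rewrite ler_pM2r ?invr_gt0// ler_normD.
  rewrite -onemt; apply: (convex_powR r1 (Itv01 t0 t1)).
    by rewrite inE/= in_itv/= andbT divr_ge0// ltW.
  by rewrite inE/= in_itv/= andbT divr_ge0// ltW.
have unit c (x : I -> R) : 0 < c -> \sum_(i <- A) `|x i| `^ r <= c `^ r ->
    \sum_(i <- A) (`|x i| / c) `^ r <= 1.
  move=> c0 xc; rewrite -(@ler_pM2l _ (c `^ r)) ?powR_gt0// mulr1 mulr_sumr.
  apply: le_trans xc; apply: ler_sum => i _.
  by rewrite -powRM ?divr_ge0 ?(ltW c0)// mulrC divfK// gt_eqF.
apply: le_trans (ler_sum _ (fun i _ => conv i)) _.
rewrite -mulr_sumr ger_pMr ?powR_gt0// big_split/= -!mulr_sumr.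
rewrite -[leRHS](subrK (M / S)) onemt [leRHS]addrC lerD//.
  by rewrite ger_pMr ?divr_gt0//; exact: (unit _ _ M0 (ha A)).
by rewrite ger_pMr ?divr_gt0//; exact: (unit _ _ M'0 (hb A)).
Qed.

Lemma lp_leZ p k a M : (1 <= p)%E -> lp_le p a M ->
  lp_le p (fun i => k * a i) (`|k| * M).
Proof.
case: p => [r| |]// r1 [M0 h]; split; rewrite ?mulr_ge0//; last first.
  by move=> i; rewrite normrM ler_wpM2l.
move=> A; rewrite powRM//.
under eq_bigr do rewrite normrM powRM//.
by rewrite -mulr_sumr ler_wpM2l ?powR_ge0.
Qed.

Lemma lp_le_dom p a b M : (1 <= p)%E -> (forall i, `|a i| <= `|b i|) ->
  lp_le p b M -> lp_le p a M.
Proof.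
case: p => [r| |]// r1 ab [M0 h]; split => //; last first.
  by move=> i; exact: le_trans (ab i) (h i).
move=> A; apply: le_trans (h A); apply: ler_sum => i _.
rewrite lee_fin in r1; have r0 : 0 <= r by apply: le_trans r1.
by apply: ge0_ler_powR; rewrite ?nnegrE.
Qed.

Lemma lp_le_weaken p a M M' : (1 <= p)%E -> M <= M' ->
  lp_le p a M -> lp_le p a M'.
Proof.
case: p => [r| |]// r1 MM' [M0 h]; split; rewrite ?(le_trans M0)//; last first.
  by move=> i; exact: le_trans (h i) MM'.
rewrite lee_fin in r1; have r0 : 0 <= r by apply: le_trans r1.
move=> A; apply: le_trans (h A) _.
by apply: ge0_ler_powR; rewrite ?nnegrE// (le_trans M0).
Qed.

Lemma cvg_powR (T : Type) (F : set_system T) (FF : ProperFilter F)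
    (f : T -> R) l r : 0 < r -> (forall t, 0 <= f t) -> f t @[t --> F] --> l ->
  f t `^ r @[t --> F] --> l `^ r.
Proof.
move=> r0 f0 fl; have l0 : 0 <= l by apply: cvgr_to_ge fl _; exact: nearW.
have [l_eq0|l_neq0] := eqVneq l 0; last first.
  have l_gt0 : 0 < l by rewrite lt_def l_neq0.
  have : {for l, continuous (@powR R ^~ r)}.
    apply: differentiable_continuous; apply/derivable1_diffP.
    by apply: derivable_powR; rewrite in_itv/= andbT.
  by move=> cl; exact: (cvg_comp _ _ fl cl).
(* The power need not be differentiable at 0; there a bound e^(1/r) on f gives the bound e on its
   r-th power. *)
rewrite l_eq0 powR0 ?gt_eqF//; apply/cvgrPdist_le => e e0.
move: fl; rewrite l_eq0 => /cvgrPdist_le /(_ (e `^ r^-1) (powR_gt0 _ e0)).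
apply: filterS => t; rewrite !sub0r !normrN !ger0_norm ?powR_ge0// => ft.
have -> : e = (e `^ r^-1) `^ r by rewrite -powRrM mulVf ?gt_eqF// powRr1// ltW.
by apply: ge0_ler_powR; rewrite ?nnegrE ?powR_ge0 ?(ltW r0).
Qed.

(** Balls are cut out by inequalities that involve finitely many coordinates each, and these pass to
    pointwise limits. *)
Lemma lp_le_lim (T : Type) (F : set_system T) (FF : ProperFilter F) p
    (a : T -> I -> R) al M : (1 <= p)%E ->
  (\forall t \near F, lp_le p (a t) M) ->
  (forall i, a t i @[t --> F] --> al i) -> lp_le p al M.
Proof.
case: p => [r| |]// r1 aM aal; last first.
  split; first by have [t []] := filter_ex aM.
  move=> i; apply: cvgr_to_le (cvg_norm (aal i)) _.
  by apply: filterS aM => t [_]; exact.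
split; first by have [t []] := filter_ex aM.
rewrite lee_fin in r1; have r0 : 0 < r by apply: lt_le_trans r1.
move=> A.
have : (fun t => \sum_(i <- A) `|a t i| `^ r) @ F --> \sum_(i <- A) `|al i| `^ r.
  apply: cvg_big => [|i _]; first exact: add_continuous.
  by apply: cvg_powR => //; exact: cvg_norm.
move=> /cvgr_to_le; apply.
by apply: filterS aM => t [_]; exact.
Qed.

Lemma in_lpD p a b : (1 <= p)%E -> in_lp p a -> in_lp p b ->
  in_lp p (fun i => a i + b i).
Proof.
move=> p1 ha hb.
have := lp_leD p1 (lp_le_norm p1 ha) (lp_le_norm p1 hb).
case: p p1 ha hb => [r| |]// r1 ha hb; first exact: in_lp_le.
move=> _ e e0; have e2 : 0 < e / 2 by lra.
have : finite_set ([set i | e / 2 <= `|a i|] `|` [set i | e / 2 <= `|b i|]).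
  by rewrite finite_setU; split; [exact: ha|exact: hb].
apply: sub_finite_set => i /= ei; have [|ai] := leP (e / 2) `|a i|; first by left.
right; have := le_trans ei (ler_normD _ _); lra.
Qed.

Lemma in_lpZ p k a : (1 <= p)%E -> in_lp p a -> in_lp p (fun i => k * a i).
Proof.
move=> p1 ha; have := lp_leZ k p1 (lp_le_norm p1 ha).
case: p p1 ha => [r| |]// r1 ha; first exact: in_lp_le.
move=> _ e e0; have k0 : 0 < `|k| + 1 by rewrite ltr_wpDl.
apply: sub_finite_set (ha (e / (`|k| + 1)) (divr_gt0 e0 k0)) => i /=.
rewrite normrM ler_pdivrMr// => /le_trans; apply.
by rewrite mulrC ler_wpM2l// lerDl.
Qed.

Lemma in_lp0 p : (1 <= p)%E -> in_lp p (fun _ : I => 0 : R).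
Proof.
case: p => [r| |]// r1; last first.
  move=> e e0; rewrite (_ : [set n | _] = set0)//.
  by apply/seteqP; split => // i /=; rewrite normr0 leNgt e0.
apply: (@in_lp_le _ _ 0) => //; split => // A.
rewrite lee_fin in r1; have r0 : r != 0 by rewrite gt_eqF// (lt_le_trans _ r1).
by rewrite big1 ?powR_ge0// => i _; rewrite normr0 powR0.
Qed.

(** For finite p a single approximation is enough, since the difference is itself in l_p. For
    [p = +oo] the ball is one of l_oo, and arbitrarily good approximations are used: c_0 is closed
    in l_oo. *)
Lemma in_lp_approx p a : (1 <= p)%E ->
  (forall e, 0 < e -> exists2 b, in_lp p b & lp_le p (fun i => a i - b i) e) ->
  in_lp p a.
Proof.
case: p => [r| |]// r1 h.
  have [b hb hab] := h _ ltr01.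
  have := in_lpD r1 hb (in_lp_le r1 hab); congr in_lp.
  by apply/funext => i; rewrite addrC subrK.
move=> e e0; have e2 : 0 < e / 2 by lra.
have [b hb [_ hab]] := h _ e2.
apply: sub_finite_set (hb _ e2) => i /= ei.
have := ler_normD (a i - b i) (b i); rewrite subrK.
have := hab i; lra.
Qed.

(** The terms divided by the radius lie in [0, 1], where t^r <= t. The radius [M + 1] is positive
    even when M = 0, so the division is legitimate. *)
Lemma asum_lp_le p a M : (1 <= p)%E -> asum_le a M -> lp_le p a (M + 1).
Proof.
move=> p1 aM; have M0 := asum_le_ge0 aM.
have aM1 i : `|a i| <= M + 1 by rewrite (le_trans (asum_le_term i aM))// lerDl.
split; first by rewrite addr_ge0.
case: p p1 => [r| |]// r1.
rewrite lee_fin in r1; have r0 : 0 < r by apply: lt_le_trans r1.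
have M10 : 0 < M + 1 by rewrite ltr_wpDl.
move=> A; apply: (@le_trans _ _ (\sum_(i <- A) (M + 1) `^ r * (`|a i| / (M + 1)))).
  apply: ler_sum => i _.
  have -> : `|a i| `^ r = (M + 1) `^ r * (`|a i| / (M + 1)) `^ r.
    by rewrite -powRM ?divr_ge0 ?(ltW M10)// mulrC divfK// gt_eqF.
  rewrite ler_wpM2l ?powR_ge0//.
  have [->|ai0] := eqVneq (a i) 0; first by rewrite normr0 mul0r powR0 ?gt_eqF.
  by apply: ge1r_powR => //; rewrite divr_gt0 ?normr_gt0//= ler_pdivrMr// mul1r.
rewrite -mulr_sumr ger_pMr ?powR_gt0// -mulr_suml ler_pdivrMr// mul1r.
by rewrite (le_trans (aM A))// lerDl.
Qed.

Lemma asummable_in_lp p a : (1 <= p)%E -> asummable a -> in_lp p a.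
Proof.
move=> p1 [M aM]; have := asum_lp_le p1 aM.
case: p p1 => [r| |]// r1; first exact: in_lp_le.
move=> _ e e0; have e2 : 0 < e / 2 by lra.
have [A0 hA0] := asummable_tail (ex_intro _ M aM) e2.
apply: (@sub_finite_set _ _ [set` A0]) => // i /= ei.
apply: contraT => iA0; have := hA0 [fset i]%fset.
rewrite big_seq_fset1 => /(_ _)/(le_trans ei) h.
suff : e <= e / 2 by lra.
by apply: h; apply/fdisjointP => j jA0; rewrite inE; apply: contraNneq iA0 => <-.
Qed.

Definition restr A a i := if i \in A then a i else 0.

(** Density of the finitely supported families. For [p = +oo] the set [A0] is the finite set of
    large terms that membership in c_0 provides. *)
Lemma lp_restr_cvg p a : (1 <= p)%E -> in_lp p a -> forall e, 0 < e ->
  exists A0, forall A, (A0 `<=` A)%fset -> lp_le p (fun i => a i - restr A a i) e.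
Proof.
case: p => [r| |]// r1 ha e e0; last first.
  have fin := ha _ e0; exists (fset_set [set n | e <= `|a n|]) => A A0A.
  split=> [|i]; first exact: ltW.
  rewrite /restr; case: ifPn => [_|iA]; first by rewrite subrr normr0 ltW.
  rewrite subr0 leNgt; apply: contra iA => /ltW ei; apply: (fsubsetP A0A).
  by rewrite in_fset_set// inE.
rewrite lee_fin in r1; have r0 : 0 < r by apply: lt_le_trans r1.
have [_ h] := @lp_le_norm r%:E _ r1 ha.
have sa : asummable (fun i => `|a i| `^ r).
  exists (lp_norm r%:E a `^ r) => A.
  by under eq_bigr do rewrite ger0_norm ?powR_ge0//.
have er0 : 0 < e `^ r by rewrite powR_gt0.
have [A0 hA0] := asummable_tail sa er0; exists A0 => A A0A.
split=> [|B]; first exact: ltW.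
have -> : \sum_(i <- B) `|a i - restr A a i| `^ r =
    \sum_(i <- (B `\` A)%fset) `|a i| `^ r.
  rewrite (sum_fset_sub _ (fsubsetIl B A)) big1_seq ?add0r; last first.
    move=> i /andP[_]; rewrite inE => /andP[_ iA].
    by rewrite /restr iA subrr normr0 powR0 ?gt_eqF.
  rewrite fsetDIr fsetDv fset0U; apply: eq_big_seq => i.
  by rewrite inE /restr => /andP[/negbTE-> _]; rewrite subr0.
have : [disjoint A0 & (B `\` A)]%fset.
  by apply/fdisjointP => i /(fsubsetP A0A) iA; rewrite inE iA.
move=> /hA0; apply: le_trans; apply: ler_sum => i _; exact: ler_norm.
Qed.
End lp_bounds.

(** * The Banach space of families *)

Section lp_space.
Variables (R : realType) (I : choiceType) (p : \bar R) (p1 : (1 <= p)%E).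

(** The proof of [1 <= p] is an argument so that the submodule structure, which depends on it, can
    be inferred from the predicate. *)
Definition lp_pred of (1 <= p)%E : {pred I -> R} := fun a => `[< in_lp p a >].

Lemma lp_pred_submod : submod_closed (lp_pred p1).
Proof.
split=> [|k a b /asboolP ha /asboolP hb]; apply/asboolP; first exact: in_lp0.
by apply: in_lpD => //; exact: in_lpZ.
Qed.

HB.instance Definition _ :=
  GRing.isSubmodClosed.Build R (I -> R) (lp_pred p1) lp_pred_submod.

Definition lp_space := {a : I -> R | a \in lp_pred p1}.

HB.instance Definition _ := gen_eqMixin lp_space.
HB.instance Definition _ := gen_choiceMixin lp_space.
HB.instance Definition _ := [isSub of lp_space for @sval _ _].
HB.instance Definition _ := [SubChoice_isSubLmodule of lp_space by <:].

Implicit Types (a b : lp_space).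

Lemma lp_space_in a : in_lp p (val a).
Proof. by have /asboolP := valP a. Qed.

Definition lp_space_of (f : I -> R) (hf : in_lp p f) : lp_space :=
  exist _ f (asboolT hf).

Lemma lp_spaceD a b i : val (a + b) i = val a i + val b i.
Proof. by []. Qed.

Definition lp_space_norm a : R := lp_norm p (val a).

(** Every norm estimate below goes through this equivalence, so the roots and suprema in the norm
    are not met again. *)
Lemma lp_space_normP a M : lp_space_norm a <= M <-> lp_le p (val a) M.
Proof.
have h := lp_le_norm p1 (lp_space_in a); split; last exact: norm_le_lp.
by move=> aM; apply: lp_le_weaken h.
Qed.

Lemma lp_space_normD a b :
  lp_space_norm (a + b) <= lp_space_norm a + lp_space_norm b.
Proof. by apply/lp_space_normP; apply: lp_leD => //; exact/lp_space_normP. Qed.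

Lemma lp_space_normZ k a : lp_space_norm (k *: a) = `|k| * lp_space_norm a.
Proof.
have le l b : lp_space_norm (l *: b) <= `|l| * lp_space_norm b.
  by apply/lp_space_normP; apply: lp_leZ => //; exact/lp_space_normP.
apply/eqP; rewrite eq_le le/=; have [->|k0] := eqVneq k 0.
  rewrite normr0 mul0r.
  by have [] : lp_le p (val (0 *: a)) (lp_space_norm (0 *: a)) by
    exact/lp_space_normP.
rewrite -ler_pdivlMl ?normr_gt0// -normfV.
by have := le k^-1 (k *: a); rewrite scalerA mulVf// scale1r.
Qed.

Lemma lp_space_norm0_eq0 a : lp_space_norm a = 0 -> a = 0.
Proof.
move=> a0; apply/val_inj/funext => i; apply/eqP; rewrite -normr_le0 -a0.
by apply: (lp_le_term _ p1); exact/lp_space_normP.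
Qed.

HB.instance Definition _ := Lmodule_isNormed.Build R lp_space
  lp_space_normD lp_space_normZ lp_space_norm0_eq0.

Lemma normr_lpP a M : `|a| <= M <-> lp_le p (val a) M.
Proof. exact: lp_space_normP. Qed.

Lemma lp_space_term a i : `|val a i| <= `|a|.
Proof. by apply: (lp_le_term _ p1); exact/normr_lpP. Qed.

(** The limit is taken coordinate by coordinate. A ball that is eventually Cauchy-small stays small
    at the limit by [lp_le_lim], and [in_lp_approx] puts the limit back into the space. *)
Lemma lp_space_complete (F : set_system lp_space) :
  ProperFilter F -> cauchy F -> cvg F.
Proof.
move=> FF /cauchyP Fc.
have coord i : cvg ((fun a : lp_space => val a i) @ F).
  apply/cauchy_cvgP/cauchy_exP => e e0; have [a aF] := Fc _ e0.
  exists (val a i).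
  suff : \forall b \near F, `|val a i - val (b : lp_space) i| < e by [].
  apply: filterS aF => b; rewrite -ball_normE /= => ab.
  by apply: le_lt_trans ab; exact: (lp_space_term (a - b)).
pose al i := lim ((fun a : lp_space => val a i) @ F).
have near_al e : 0 < e ->
    exists2 b : lp_space, F (ball b e) & forall c, F (ball c e) -> lp_le p (fun i
      => val c i - al i) e.
  move=> e0; have [b bF] := Fc _ e0; exists b => // c cF.
  apply: (@lp_le_lim _ _ _ F _ _ (fun a i => val c i - val a i)) => //.
    apply: filterS cF => a; rewrite -ball_normE /= => ca.
    exact: (proj1 (normr_lpP (c - a) e) (ltW ca)).
  by move=> i; apply: cvgB; [exact: cvg_cst|exact: coord].
have al_in : in_lp p al.
  apply: in_lp_approx => // e e0; have [b bF hb] := near_al _ e0.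
  exists (val b); first exact: lp_space_in.
  apply: (lp_le_dom p1 _ (hb _ bF)) => i; by rewrite distrC.
apply/cvg_ex; exists (lp_space_of al_in); apply/cvgrPdist_le => e e0.
have e2 : 0 < e / 2 by lra.
have [b bF hb] := near_al _ e2.
have hbe := hb _ bF; apply: filterS bF => a; rewrite -ball_normE /= => ba.
have h1 : `|b - lp_space_of al_in| <= e / 2.
  exact: (proj2 (normr_lpP (b - lp_space_of al_in) _) hbe).
rewrite distrC -[a](subrK b) -addrA (le_trans (ler_normD _ _))//.
by rewrite [leRHS]splitr lerD// distrC ltW.
Qed.

HB.instance Definition _ := Uniform_isComplete.Build lp_space lp_space_complete.

Lemma restr_asum_le (A : {fset I}) (f : I -> R) :
  asum_le (restr A f) (\sum_(i <- A) `|f i|).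
Proof.
move=> B.
rewrite (sum_fset_sub _ (fsubsetIr A B)) [X in _ + X]big1_seq ?addr0; last first.
  move=> i /andP[_]; rewrite !inE => /andP[]; rewrite /restr.
  by case: ifP => //= _; rewrite ?normr0// => /[swap] ->.
apply: (le_trans _ (ler_sum_fset _ (fsubsetIl A B))) => //.
by apply: ler_sum => i _; rewrite /restr; case: ifP; rewrite ?normr0.
Qed.

Definition lp_restr (A : {fset I}) (f : I -> R) : lp_space :=
  lp_space_of (asummable_in_lp p1 (ex_intro _ _ (restr_asum_le A f))).

Definition lp_delta i : lp_space := lp_restr [fset i]%fset (fun=> 1).

(** The 2 is [M + 1] for M = 1 in [asum_lp_le]; what counts is a bound uniform in [i]. *)
Lemma lp_delta_norm i : `|lp_delta i| <= 2.
Proof.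
apply/normr_lpP; have := asum_lp_le p1 (restr_asum_le [fset i]%fset (fun=> 1)).
by rewrite big_seq_fset1 normr1.
Qed.

Lemma lp_restrE (A : {fset I}) f :
  lp_restr A f = \sum_(i <- A) f i *: lp_delta i.
Proof.
apply/val_inj/funext => j /=.
have -> : val (\sum_(i <- A) f i *: lp_delta i) j =
    \sum_(i <- A) f i * val (lp_delta i) j.
  by elim/big_ind2 : _ => // a x b y ? ?; rewrite lp_spaceD; congr +%R.
rewrite /= /restr.
have [jA|jA] := boolP (j \in A); last first.
  rewrite big1_seq// => i /andP[_ iA]; rewrite inE.
  by case: eqP => [ji|]; [rewrite ji iA in jA|rewrite mulr0].
rewrite (big_fsetD1 _ jA)/= inE eqxx mulr1 big1_seq ?addr0// => i /andP[_].
by rewrite !inE eq_sym => /andP[/negbTE-> _]; rewrite mulr0.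
Qed.

Lemma lp_restr_cvg_space (a : lp_space) :
  lp_restr A (val a) @[A --> summability.totally] --> a.
Proof.
apply/cvgrPdist_le => e e0.
have [A0 hA0] := lp_restr_cvg p1 (lp_space_in a) e0.
by exists A0 => // A /= /hA0 h; apply/normr_lpP.
Qed.

End lp_space.

(** * The dual space *)

Section dual_space.
Variables (R : realType) (V : normedModType R).

Definition dual_pred : {pred V -> R} := fun G => `[< scalar G /\ continuous G >].

Lemma dual_pred_submod : submod_closed dual_pred.
Proof.
split=> [|k G H /asboolP[lG cG] /asboolP[lH cH]]; apply/asboolP; split.
- by move=> k x y; rewrite /= mulr0 addr0.
- by move=> x; exact: cvg_cst.
- move=> l x y; transitivity (k * G (l *: x + y) + H (l *: x + y)); first by [].
  rewrite lG lH; transitivity (l * (k * G x + H x) + (k * G y + H y)); last by [].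
  ring.
- move=> x; apply: cvgD; last exact: cH.
  by apply: cvgMl_tmp; exact: cG.
Qed.

HB.instance Definition _ :=
  GRing.isSubmodClosed.Build R (V -> R) dual_pred dual_pred_submod.

Definition dual_space := {G : V -> R | G \in dual_pred}.

HB.instance Definition _ := gen_eqMixin dual_space.
HB.instance Definition _ := gen_choiceMixin dual_space.
HB.instance Definition _ := [isSub of dual_space for @sval _ _].
HB.instance Definition _ := [SubChoice_isSubLmodule of dual_space by <:].

Implicit Types (G H : dual_space).

Lemma dual_spaceP G : scalar (val G) /\ continuous (val G).
Proof. by have /asboolP := valP G. Qed.

Definition dual_space_of (G : V -> R) (lG : scalar G) (cG : continuous G) :
  dual_space := exist _ G (asboolT (conj lG cG)).

Lemma dual_space_bounded G : exists M, forall x, `|val G x| <= M * `|x|.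
Proof.
have [lG cG] := dual_spaceP G.
pose f : {linear V -> R^o} := HB.pack (val G) (GRing.isLinear.Build _ _ _ _ _ lG).
have /linear_bounded_continuous/linear_boundedP h : continuous f by exact: cG.
by have [r [_ /(_ (r + 1))]] := h; rewrite ltrDl ltr01 => /(_ isT); exists (r + 1).
Qed.

Lemma dual_spaceZ G k x : val G (k *: x) = k * val G x.
Proof.
have [lG _] := dual_spaceP G.
have G0 : val G 0 = 0.
  by have := lG (-1) 0 0; rewrite scaler0 addr0 mulN1r addNr.
by have := lG k x 0; rewrite !addr0 G0 addr0.
Qed.

Lemma dual_space0 G : val G 0 = 0.
Proof. by rewrite -(scale0r (0 : V)) dual_spaceZ mul0r. Qed.

Lemma dual_spaceD G x y : val G (x + y) = val G x + val G y.
Proof.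
by have [lG _] := dual_spaceP G; have := lG 1 x y; rewrite scale1r mul1r.
Qed.

Lemma dual_norm_ge0 G : 0 <= dual_norm (val G).
Proof.
have [M hM] := dual_space_bounded G; apply: ub_le_sup; last first.
  by exists 0; [rewrite /= normr0|rewrite dual_space0 normr0].
exists `|M| => _ [x /= x1 <-]; apply: (le_trans (hM x)).
by rewrite (le_trans (ler_wpM2r _ (ler_norm M)))// ler_piMr.
Qed.

Lemma dual_norm_ub G x : `|val G x| <= dual_norm (val G) * `|x|.
Proof.
have [->|x0] := eqVneq x 0; first by rewrite dual_space0 !normr0 mulr0.
rewrite -ler_pdivrMr ?normr_gt0//.
have [M hM] := dual_space_bounded G; apply: ub_le_sup.
  exists `|M| => _ [y /= y1 <-]; apply: (le_trans (hM y)).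
  by rewrite (le_trans (ler_wpM2r _ (ler_norm M)))// ler_piMr.
exists (`|x|^-1 *: x); first by rewrite /= normrZ normfV normr_id mulVf ?normr_eq0.
by rewrite dual_spaceZ normrM normfV normr_id mulrC.
Qed.

Lemma dual_norm_le G M : (forall x, `|x| <= 1 -> `|val G x| <= M) ->
  dual_norm (val G) <= M.
Proof.
move=> GM; apply: ge_sup => [|_ [x /= x1 <-]]; last exact: GM.
by exists `|val G 0|; exists 0 => //=; rewrite normr0.
Qed.

Let norm G := dual_norm (val G).

Lemma dual_normD G H : norm (G + H) <= norm G + norm H.
Proof.
apply: dual_norm_le => x x1; apply: (le_trans (ler_normD _ _)); apply: lerD.
  by rewrite (le_trans (dual_norm_ub G x))// ler_piMr ?dual_norm_ge0.
by rewrite (le_trans (dual_norm_ub H x))// ler_piMr ?dual_norm_ge0.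
Qed.

Lemma dual_normZ k G : norm (k *: G) = `|k| * norm G.
Proof.
have le l H : norm (l *: H) <= `|l| * norm H.
  apply: dual_norm_le => x x1; rewrite [leLHS]normrM ler_wpM2l//.
  by rewrite (le_trans (dual_norm_ub H x))// ler_piMr ?dual_norm_ge0.
apply/eqP; rewrite eq_le le/=; have [->|k0] := eqVneq k 0.
  by rewrite normr0 mul0r dual_norm_ge0.
rewrite -ler_pdivlMl ?normr_gt0// -normfV.
by have := le k^-1 (k *: G); rewrite scalerA mulVf// scale1r.
Qed.

Lemma dual_norm0_eq0 G : norm G = 0 -> G = 0.
Proof.
move=> G0; apply/val_inj/funext => x; apply/eqP; rewrite -normr_le0.
by rewrite (le_trans (dual_norm_ub G x))// [dual_norm _]G0 mul0r.
Qed.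

HB.instance Definition _ := Lmodule_isNormed.Build R dual_space
  dual_normD dual_normZ dual_norm0_eq0.

Definition dual_eval (G : dual_space) : V -> R := val G.

Lemma dual_eval_linear : linear dual_eval.
Proof. by []. Qed.

HB.instance Definition _ := GRing.isLinear.Build _ _ _ _ dual_eval dual_eval_linear.

Lemma dual_eval_isometry : dual_isometry (dual_eval : {linear _ -> _}).
Proof.
split=> // [G|G lG cG]; first exact: dual_spaceP.
by exists (dual_space_of lG cG).
Qed.

Lemma dual_space_bound_of (G : V -> R) M : scalar G ->
  (forall x, `|G x| <= M * `|x|) -> continuous G.
Proof.
move=> lG hM.
pose f : {linear V -> R^o} := HB.pack G (GRing.isLinear.Build _ _ _ _ _ lG).
suff : continuous f by [].
apply/linear_bounded_continuous/linear_boundedP; exists M; split.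
  by rewrite num_real.
by move=> r Mr x; rewrite (le_trans (hM x))// ler_wpM2r// ltW.
Qed.

End dual_space.

(** * Reproducing kernel Banach spaces of sequences *)

Section sequence_RKBS.
Context (dT : measure_display) (T : measurableType dT) (R : realType)
  (I : choiceType) (phi : I -> T -> R) (K : T -> T -> R).
Hypothesis phi_sum : forall x, asummable (phi ^~ x).
Hypothesis phi_inj : forall (a : I -> R) (C : R), (forall i, `|a i| <= C) ->
  (forall x, has_sum (fun i => a i * phi i x) 0) -> forall i, a i = 0.
Hypothesis phi_meas : forall (a : I -> R) (C : R)
  (f : T -> R), (forall i, `|a i| <= C) ->
  (forall x, has_sum (fun i => a i * phi i x) (f x)) -> measurable_fun setT f.
Hypothesis K_sum : forall x y, has_sum (fun i => phi i x * phi i y) (K x y).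
Arguments K_sum : clear implicits.
Variables (p : \bar R) (p1 : (1 <= p)%E).

Notation B := (lp_space I p1).
Notation expansion a f := (forall x, has_sum (fun i => a i * phi i x) (f x)).

Lemma expand_ex (a : B) x : exists s, has_sum (fun i => val a i * phi i x) s.
Proof.
apply: asummable_has_sum; apply: (asummable_mull (C := `|a|)) (phi_sum x) => i.
exact: lp_space_term.
Qed.

Definition expand (a : B) (x : T) : R := sval (cid (expand_ex a x)).

Lemma expandP (a : B) : expansion (val a) (expand a).
Proof. by move=> x; exact: (svalP (cid (expand_ex a x))). Qed.

Arguments expandP : clear implicits.

Lemma expandE (a : B) f : expansion (val a) f -> expand a = f.
Proof. by move=> h; apply/funext => x; exact: has_sum_uniq (expandP a x) (h x). Qed.

Lemma expand_linear : linear expand.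
Proof.
move=> k a b; apply: expandE => x.
have := has_sumD (@has_sumZ _ _ k _ _ (expandP a x)) (expandP b x).
apply: eq_has_sum => i.
by transitivity ((k * val a i + val b i) * phi i x); [rewrite mulrDl mulrA|].
Qed.

HB.instance Definition _ := GRing.isLinear.Build _ _ _ _ expand expand_linear.

Lemma expand_inj : injective expand.
Proof.
move=> a b ab; apply/eqP; rewrite -subr_eq0; apply/eqP/val_inj/funext => i.
apply: (@phi_inj (val (a - b)) `|a - b|); first exact: lp_space_term.
have E : expand (a - b) = expand a - expand b by exact: linearB.
by move=> x; have := expandP (a - b) x; rewrite E ab subrr.
Qed.

Lemma expand_meas a : measurable_fun setT (expand a).
Proof. by apply: phi_meas (expandP a) => i; exact: lp_space_term. Qed.

Definition lp_fun_space : fun_space T B :=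
  @FunSpace _ T R B expand expand_inj expand_meas.

Lemma expand_range : range expand = [set f | exists2 a, in_lp p a & expansion a f].
Proof.
apply/seteqP; split=> [_ [a _ <-]|f [a ha af]].
  by exists (val a); [exact: lp_space_in|exact: expandP].
by exists (lp_space_of p1 ha) => //; exact: expandE.
Qed.

Lemma expand_norm (v : B) a : in_lp p a -> expansion a (expand v) ->
  `|v| = lp_norm p a.
Proof.
move=> ha av; suff -> : v = lp_space_of p1 ha by [].
by apply: expand_inj; rewrite (expandE (a := lp_space_of p1 ha) av).
Qed.

Definition lp_kernel (y : T) : B := lp_space_of p1 (asummable_in_lp p1 (phi_sum y)).

Lemma expand_kernel x y : expand (lp_kernel y) x = K x y.
Proof.
rewrite (@expandE _ (K^~ y))// => {}x; have := K_sum x y.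
by apply: eq_has_sum => i; rewrite mulrC.
Qed.

Definition dual_fun (G : dual_space B) (y : T) : R := val G (lp_kernel y).

Lemma dual_fun_linear : linear dual_fun.
Proof. by []. Qed.

HB.instance Definition _ := GRing.isLinear.Build _ _ _ _ dual_fun dual_fun_linear.

(** Continuity of [G] along the finite restrictions of [a]. Applied to [lp_kernel y], it exhibits
    [dual_fun G] as an expansion with the bounded coefficients [val G (lp_delta p1 i)], to which
    [phi_inj] and [phi_meas] apply. *)
Lemma dual_has_sum (G : dual_space B) (a : B) :
  has_sum (fun i => val G (lp_delta p1 i) * val a i) (val G a).
Proof.
have [_ cG] := dual_spaceP G.
have := cvg_comp _ _ (lp_restr_cvg_space (a := a)) (cG a).
apply: cvg_trans; apply: near_eq_cvg; apply: nearW => A /=.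
rewrite partial_sumE lp_restrE.
elim/big_ind2 : _ => [|x b y c <- <-|i _]; rewrite ?dual_space0 ?dual_spaceD//.
by rewrite dual_spaceZ mulrC.
Qed.

Arguments dual_has_sum : clear implicits.

Lemma dual_delta_bound (G : dual_space B) i :
  `|val G (lp_delta p1 i)| <= dual_norm (val G) * 2.
Proof.
apply: (le_trans (dual_norm_ub _ _)).
by rewrite ler_wpM2l ?dual_norm_ge0 ?lp_delta_norm.
Qed.

Lemma dual_fun_inj : injective dual_fun.
Proof.
move=> G H GH; apply/eqP; rewrite -subr_eq0; set D := G - H.
suff D0 i : val D (lp_delta p1 i) = 0.
  apply/eqP/val_inj/funext => a; apply: has_sum_uniq (dual_has_sum D a) _.
  by apply: eq_has_sum (@has_sum0 R I) => i; rewrite D0 mul0r.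
apply: (phi_inj (a := fun i => val D (lp_delta p1 i)));
  first exact: dual_delta_bound.
move=> y; have := dual_has_sum D (lp_kernel y).
suff -> : val D (lp_kernel y) = 0 by [].
by have /(congr1 (@^~ y)) := GH; rewrite /dual_fun =>
  h; apply/eqP; rewrite subr_eq0 h.
Qed.

Lemma dual_fun_meas G : measurable_fun setT (dual_fun G).
Proof.
apply: (phi_meas (a := fun i => val G (lp_delta p1 i)));
  first exact: dual_delta_bound.
by move=> y; exact: dual_has_sum.
Qed.

Definition dual_fun_space : fun_space T (dual_space B) :=
  @FunSpace _ T R (dual_space B) dual_fun dual_fun_inj dual_fun_meas.

Lemma expand_scalar x : scalar (expand ^~ x).
Proof. by move=> k a b; rewrite linearP. Qed.

Lemma expand_continuous x : continuous (expand ^~ x).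
Proof.
have [M phiM] := phi_sum x.
apply: (dual_space_bound_of (M := M) (expand_scalar x)) => a.
apply: has_sum_norm_le (expandP a x) _ => A.
under eq_bigr do rewrite normrM.
rewrite mulrC; apply: (le_trans _ (ler_wpM2l (normr_ge0 _) (phiM A))).
rewrite mulr_sumr; apply: ler_sum => i _.
by rewrite ler_wpM2r//; exact: lp_space_term.
Qed.

Definition lp_evaluation x : dual_space B :=
  dual_space_of (expand_scalar x) (expand_continuous (x := x)).

Lemma dual_fun_evaluation x : dual_fun (lp_evaluation x) = K x.
Proof. by apply/funext => y; exact: expand_kernel. Qed.

Lemma lp_space_two_sided : two_sided_RKBS lp_fun_space K.
Proof.
exists (dual_space B), dual_fun_space, (@dual_eval R B); split.
- exact: dual_eval_isometry.
(* Injectivity identifies [k]. Both reproducing identities then hold by definition, as [J] is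
   evaluation and [dual_fun g y] is the pairing of [g] with [lp_kernel y]. *)
- split=> [x|x k]; first by exists (lp_evaluation x); exact: dual_fun_evaluation.
  by rewrite -dual_fun_evaluation => /dual_fun_inj ->.
- have expandK y : expand (lp_kernel y) = K ^~ y.
    by apply/funext => x; exact: expand_kernel.
  split=> [y|y k]; first by exists (lp_kernel y); exact: expandK.
  by rewrite -expandK => /expand_inj -> g.
Qed.

End sequence_RKBS.

Lemma two_sided_right (dT : measure_display) (T : measurableType dT)
    (R : realType) (B : completeNormedModType R) (b : fun_space T B) K :
  two_sided_RKBS b K -> right_sided_RKBS b K.
Proof. by move=> [F [f [J [iJ rJ _]]]]; exists F, f, J. Qed.

(** * Hermite polynomials *)

Section hermite_polynomials.
Variable R : realType.
Implicit Types (n : nat) (x y Y Q q C : R).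

(** The three-term recurrence is taken as the definition; [hermiteE] matches it with Rodrigues'
    formula. *)
Fixpoint hermite_poly n x : R :=
  match n with
  | 0 => 1
  | m.+1 => match m with
            | 0 => 2 * x
            | k.+1 => 2 * x * hermite_poly m x - 2 * m%:R * hermite_poly k x
            end
  end.

#[local] Arguments hermite_poly : simpl never.

(** At n = 0 the truncated index [n.-1] is harmless, because its term carries the factor 0. *)
Lemma hermite_polyS n x : hermite_poly n.+1 x =
  2 * x * hermite_poly n x - 2 * n%:R * hermite_poly n.-1 x.
Proof. by case: n => [|n] //; rewrite /hermite_poly mulr0 mul0r subr0 mulr1. Qed.

Lemma is_derive_hermite_poly n x :
  is_derive x 1 (hermite_poly n) (2 * n%:R * hermite_poly n.-1 x).
Proof.
suff : is_derive x 1 (hermite_poly n) (2 * n%:R * hermite_poly n.-1 x) /\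
    is_derive x 1 (hermite_poly n.+1) (2 * n.+1%:R * hermite_poly n x) by case.
elim: n => [|n [IH1 IH2]].
  split; first by rewrite mulr0 mul0r; exact: is_derive_cst.
  rewrite /= !mulr1; apply: is_derive_eq.
  rewrite /GRing.scale /=; ring.
split => //.
apply: (@is_derive_eq _ _ _ (fun y => 2 * y * hermite_poly n.+1 y - 2 * n.+1%:R *
  hermite_poly n y)).
rewrite /GRing.scale /= !hermite_polyS /= -!natr1; ring.
Qed.

Lemma derive1n_gauss n x : derive1n n (fun y : R => expR (- y ^+ 2)) x =
  (-1) ^+ n * hermite_poly n x * expR (- x ^+ 2).
Proof.
elim: n x => [|n IH] x; first by rewrite derive1n0 expr0 !mul1r.
rewrite derive1nS (_ : derive1n n _ = (fun y =>
  (-1) ^+ n * hermite_poly n y * expR (- y ^+ 2))); last exact/funext.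
rewrite derive1E; apply: derive_val.
have dH := is_derive_hermite_poly n x.
apply: is_derive_eq.
rewrite /GRing.scale /= hermite_polyS [(-1) ^+ n.+1]exprS; ring.
Qed.

Lemma hermiteE n x : hermite n x = hermite_poly n x.
Proof.
have e1 : expR (x ^+ 2) * expR (- x ^+ 2) = 1 by rewrite -expRD addrN expR0.
have e2 : (-1) ^+ n * (-1) ^+ n = 1 :> R by rewrite -exprMn mulrNN mulr1 expr1n.
rewrite /hermite derive1n_gauss -[RHS]mul1r -[in RHS]e1 -[RHS]mul1r -[in RHS]e2;
  ring.
Qed.

(** The squared norm of H_n in L^2 of the measure pi^(-1/2) exp(- x^2) dx. *)
Definition hermite_weight n : R := 2 ^+ n * n`!%:R.

Lemma hermite_weight0 : hermite_weight 0 = 1.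
Proof. by rewrite /hermite_weight expr0 mul1r. Qed.

Lemma hermite_weightS n : hermite_weight n.+1 = 2 * n.+1%:R * hermite_weight n.
Proof. by rewrite /hermite_weight exprS factS natrM; ring. Qed.

Lemma hermite_weight_ge1 n : 1 <= hermite_weight n.
Proof.
elim: n => [|n IH]; first by rewrite hermite_weight0.
rewrite hermite_weightS (le_trans IH)// ler_peMl ?(le_trans ler01 IH)//.
by rewrite -natrM ler1n; lia.
Qed.

Lemma hermite_weight_gt0 n : 0 < hermite_weight n.
Proof. by rewrite (lt_le_trans _ (hermite_weight_ge1 n)). Qed.

Lemma hermite_poly_segment Y n : 0 <= Y ->
  exists B, forall x, `|x| <= Y -> `|hermite_poly n x| <= B.
Proof.
move=> Y0; suff [] : (exists B, forall x, `|x| <= Y -> `|hermite_poly n x| <= B) /\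
  (exists B, forall x, `|x| <= Y -> `|hermite_poly n.+1 x| <= B) by [].
elim: n => [|n [[B hB] [C hC]]].
  split; first by exists 1 => x _; rewrite normr1.
  by exists (2 * Y) => x xY; rewrite normrM normr_nat ler_wpM2l.
split; first by exists C.
exists (2 * Y * C + 2 * n.+1%:R * B) => x xY; rewrite hermite_polyS.
apply: (le_trans (ler_normB _ _)); rewrite !normrM !normr_nat lerD//.
  by rewrite ler_pM ?mulr_ge0// ?ler_wpM2l//; exact: hC.
by rewrite ler_wpM2l// ?mulr_ge0//; exact: hB.
Qed.

(** Provides the constant for the finitely many indices below the threshold of the growth
    induction. *)
Lemma hermite_poly_initial Y Q m : 0 <= Y -> 1 < Q -> exists2 C, 0 < C &
  forall n x, (n <= m)%N -> `|x| <= Y ->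
    hermite_poly n x ^+ 2 <= C * Q ^+ n * hermite_weight n.
Proof.
move=> Y0 Q1.
have W n : 1 <= Q ^+ n * hermite_weight n.
  by rewrite -[1]mulr1 ler_pM// ?hermite_weight_ge1// exprn_ege1// ltW.
have step n B C x : 0 <= C -> `|hermite_poly n x| <= B ->
    hermite_poly n x ^+ 2 <= (C + B ^+ 2) * Q ^+ n * hermite_weight n.
  move=> C0 hB; have B2 : hermite_poly n x ^+ 2 <= B ^+ 2.
    rewrite -[leLHS]real_normK ?num_real// lerXn2r ?nnegrE//.
    exact: le_trans (normr_ge0 _) hB.
  rewrite -mulrA; apply: (@le_trans _ _ ((C + B ^+ 2) * 1)).
    by rewrite mulr1 (le_trans B2)// lerDr.
  by rewrite ler_wpM2l// addr_ge0 ?sqr_ge0.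
elim: m => [|m [C C0 IH]].
  have [B hB] := hermite_poly_segment 0 Y0; exists (1 + B ^+ 2).
    by rewrite ltr_pwDl ?sqr_ge0.
  by case=> // x _ /hB; exact: step.
have [B hB] := hermite_poly_segment m.+1 Y0; exists (C + B ^+ 2).
  by rewrite ltr_pwDl ?sqr_ge0.
move=> n x; rewrite leq_eqVlt => /orP[/eqP -> /hB|]; first exact/step/ltW.
rewrite ltnS => nm /(IH _ _ nm)/le_trans; apply.
rewrite -!mulrA ler_wpM2r ?lerDl ?sqr_ge0//.
exact: le_trans (W n).
Qed.

(* By [2ab <= d a^2 + b^2 / d], the squares of the normalized Hermite polynomials
   satisfy [h_(n+2)^2 <= d h_(n+1)^2 + (1 + d) h_n^2] for n large. *)
Lemma hermite_poly_growth Y Q : 0 <= Y -> 1 < Q -> exists2 C, 0 < C &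
  forall n x, `|x| <= Y -> hermite_poly n x ^+ 2 <= C * Q ^+ n * hermite_weight n.
Proof.
move=> Y0 Q1; pose d := Q - 1; have d0 : 0 < d by rewrite subr_gt0.
(* For n + 2 >= [D] the coefficient (1 + 1/d) 2 Y^2 contributed by x is at most d (n + 2), which is
   what the factor Q = 1 + d gains in one step. *)
pose D := d^-1 * ((1 + d^-1) * 2 * Y ^+ 2).
have [m Dm] : exists m, D <= m%:R.
  by exists (Num.truncn D).+1; exact/ltW/truncnS_gt.
have [C C0 init] := hermite_poly_initial m.+1 Y0 Q1.
exists C => // n x xY.
suff [] : hermite_poly n x ^+ 2 <= C * Q ^+ n * hermite_weight n /\
  hermite_poly n.+1 x ^+ 2 <= C * Q ^+ n.+1 * hermite_weight n.+1 by [].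
elim: n => [|n [IH1 IH2]]; first by split; exact: init.
split=> //; have [nm|mn] := leqP n.+2 m.+1; first exact: init.
have {}Dm : (1 + d^-1) * 2 * Y ^+ 2 <= d * n.+2%:R.
  rewrite -ler_pdivrMl//; apply: (le_trans Dm); rewrite ler_nat; lia.
have xY2 : x ^+ 2 <= Y ^+ 2 by rewrite -[leLHS]real_normK ?num_real// lerXn2r
  ?nnegrE.
rewrite hermite_polyS /=; move: IH1 IH2; rewrite !hermite_weightS ![Q ^+ _.+1]exprS.
set a := hermite_poly n.+1 x; set b := hermite_poly n x.
set W := hermite_weight n; set q := Q ^+ n => hb ha.
have W0 : 0 < W := hermite_weight_gt0 n.
have q0 : 0 < q by rewrite exprn_gt0// (lt_trans ltr01).
have Qd : Q = 1 + d by rewrite /d addrC subrK.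
have k0 : 0 < n.+1%:R :> R by rewrite ltr0n.
have -> : n.+2%:R = n.+1%:R + 1 :> R by rewrite natr1.
have {}Dm : (1 + d^-1) * 2 * Y ^+ 2 <= d * (n.+1%:R + 1) by rewrite natr1.
move: (n.+1%:R : R) k0 Dm ha => k k0 Dm ha.
have young : (2 * x * a - 2 * k * b) ^+ 2 <=
    (1 + d^-1) * (4 * (x ^+ 2 * a ^+ 2)) + Q * (4 * k ^+ 2 * b ^+ 2).
  rewrite -subr_ge0 (_ : _ - _ = d^-1 * (2 * x * a + d * (2 * k * b)) ^+ 2).
    by rewrite mulr_ge0 ?sqr_ge0// invr_ge0 ltW.
  by rewrite Qd; field; rewrite gt_eqF.
apply: (le_trans young).
have d1 : 0 <= 1 + d^-1 by rewrite addr_ge0 ?invr_ge0 ?ltW.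
have ha' : x ^+ 2 * a ^+ 2 <= Y ^+ 2 * (C * (Q * q) * (2 * k * W)).
  by rewrite ler_pM ?sqr_ge0.
have hb' : 4 * k ^+ 2 * b ^+ 2 <= 4 * k ^+ 2 * (C * q * W).
  by rewrite ler_wpM2l// mulr_ge0 ?sqr_ge0.
have Q0 : 0 < Q by rewrite (lt_trans ltr01).
apply: (@le_trans _ _ ((1 + d^-1) * (4 * (Y ^+ 2 * (C * (Q * q) * (2 * k * W)))) +
    Q * (4 * k ^+ 2 * (C * q * W)))).
  by apply: lerD; [rewrite ler_wpM2l// ler_wpM2l|rewrite ler_wpM2l// ltW].
rewrite (_ : _ + _ = C * Q * q * W * 4 * k * ((1 + d^-1) * 2 * Y ^+ 2 + k));
  last by ring.
rewrite (_ : C * (Q * (Q * q)) * _ = C * Q * q * W * 4 * k * (Q * (k + 1)));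
  last by ring.
rewrite ler_wpM2l//; first by rewrite !mulr_ge0 ?ltW.
by rewrite Qd; lra.
Qed.

Lemma hermite_poly_bound Y q : 0 <= Y -> 1 < q -> exists2 C, 0 < C &
  forall n x, `|x| <= Y ->
    `|hermite_poly n x| <= C * q ^+ n * Num.sqrt (hermite_weight n).
Proof.
move=> Y0 q1; have q0 : 0 < q by rewrite (lt_trans ltr01).
have [C C0 hC] : exists2 C, 0 < C & forall n x, `|x| <= Y ->
    hermite_poly n x ^+ 2 <= C * (q ^+ 2) ^+ n * hermite_weight n.
  by apply: hermite_poly_growth => //; rewrite expr_gt1// ltW.
exists (Num.sqrt C) => [|n x xY]; first by rewrite sqrtr_gt0.
rewrite -sqrtr_sqr; have -> : q ^+ n = Num.sqrt ((q ^+ 2) ^+ n).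
  by rewrite exprAC sqrtr_sqr ger0_norm// exprn_ge0// ltW.
rewrite -!sqrtrM ?mulr_ge0 ?exprn_ge0 ?(ltW C0) ?(ltW q0)//.
exact/ler_wsqrtr/hC.
Qed.

Lemma hermite_poly_neq0 n : exists x, hermite_poly n x != 0.
Proof.
elim: n => [|n [x hx]]; first by exists 0; rewrite oner_eq0.
have [//|/forallNP h] := pselect (exists x, hermite_poly n.+1 x != 0).
have H0 : hermite_poly n.+1 = fun=> 0.
  by apply/funext => y; apply/eqP; have /negP := h y; rewrite negbK.
have := is_derive_hermite_poly n.+1 x; rewrite H0 => dH.
have := @derive_val _ _ _ _ _ _ _ dH; rewrite derive_cst /= => /esym/eqP.
by rewrite !mulf_eq0 (negbTE hx) !pnatr_eq0.
Qed.

End hermite_polynomials.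

(** * Uniqueness of Hermite expansions *)

Lemma lipschitz_of_derive (R : realType) (f df : R -> R) (Y M : R) :
  (forall z : R, is_derive z (1 : R) f (df z)) -> (forall z, `|z| <= Y -> `|df z|
    <= M) ->
  forall x y, `|x| <= Y -> `|y| <= Y -> `|f y - f x| <= M * `|y - x|.
Proof.
move=> fd dM x y; wlog xy : x y / x <= y.
  move=> h xY yY; have [|/ltW] := leP x y => xy; first exact: h.
  by rewrite distrC (distrC y); exact: h.
rewrite (ler_norml x) (ler_norml y) => /andP[Yx xY] /andP[Yy yY].
have fc : {within `[x, y], continuous f}.
  by apply: derivable_within_continuous => z _; have [] := fd z.
have [c] := MVT_segment xy (fun z _ => fd z) fc.
rewrite in_itv/= => /andP[xc cy] ->.
rewrite [leLHS](normrM (df c) (y - x)) ler_wpM2r// dM//.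
by rewrite ler_norml (le_trans Yx xc) (le_trans cy yY).
Qed.

Lemma natX_le_geometric (R : realType) j (r : R) : 1 < r -> exists2 C, 0 < C &
  forall n, n%:R ^+ j <= C * r ^+ n.
Proof.
move=> r1; have r0 : 0 < r by rewrite (lt_trans ltr01).
case: j => [|j].
  by exists 1 => // n; rewrite expr0 mul1r exprn_ege1// ltW.
have t0 : 0 < ln r by rewrite ln_gt0.
(* One term of the exponential series at n ln r, whose sum is r^n, bounds the power of n. *)
exists (j.+1`!%:R / ln r ^+ j.+1) => [|n].
  by rewrite divr_gt0 ?exprn_gt0// ltr0n fact_gt0.
have := @expR_ge1Dxn R (ln r * n%:R) j (mulr_ge0 (ltW t0) (ler0n _ _)).
rewrite expRM_natr lnK ?posrE// exprMn => h.
rewrite mulrAC ler_pdivlMr ?exprn_gt0// -ler_pdivrMl ?ltr0n ?fact_gt0//.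
by rewrite mulrC [n%:R ^+ _ * _]mulrC; apply: le_trans h; rewrite lerDr.
Qed.

Lemma exp_series_le (R : realType) K (x : R) : 0 <= x ->
  \sum_(k < K) exp_coeff x k <= expR x.
Proof.
move=> x0; rewrite -(big_mkord xpredT (exp_coeff x)).
apply: nondecreasing_cvgn_le (is_cvg_series_exp_coeff x) K.
apply: nondecreasing_series => k _ _.
by rewrite /exp_coeff /= divr_ge0 ?exprn_ge0.
Qed.

Section hermite_families.
Variables (R : realType) (I : choiceType) (nu : I -> nat).
Implicit Types (c : I -> R) (G : nat -> R -> R) (x y Y q : R).

Local Notation weight n := (Num.sqrt (hermite_weight R n)).

(** Growth like that of H_n, locally uniformly and up to any exponential factor. The class is stable
    under multiplication by n and under lowering the index, so it contains the derivatives of the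
    H_n. *)
Definition hermite_tame G := forall Y q, 0 <= Y -> 1 < q -> exists2 C, 0 < C &
  forall n x, `|x| <= Y -> `|G n x| <= C * q ^+ n * weight n.

(** The counterpart of [hermite_tame]: coefficients that keep some exponential factor q > 1 in
    reserve, so that their products with tame functions are absolutely summable. *)
Definition hermite_summable c := exists2 q, 1 < q &
  asummable (fun i => c i * q ^+ nu i * weight (nu i)).

Lemma sqrt_gt1 q : 1 < q -> 1 < Num.sqrt q.
Proof. by move=> q1; rewrite -[ltLHS]sqrtr1 ltr_sqrt// (lt_trans ltr01). Qed.

(** Splits the reserve q: one half is spent on a polynomial or Hermite factor, the other half is
    kept. *)
Lemma sqrtX q n : 0 <= q -> q ^+ n = Num.sqrt q ^+ n * Num.sqrt q ^+ n.
Proof. by move=> q0; rewrite -exprMn -expr2 sqr_sqrtr. Qed.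

Lemma hermite_tame_natM G : hermite_tame G -> hermite_tame (fun n x =>
  n%:R * G n x).
Proof.
move=> tG Y q Y0 q1; have q0 : 0 <= q by rewrite ltW// (lt_trans ltr01).
have [C C0 hC] := tG Y _ Y0 (sqrt_gt1 q1).
have [D D0 hD] := natX_le_geometric 1 (sqrt_gt1 q1).
exists (D * C) => [|n x xY]; first exact: mulr_gt0.
rewrite normrM normr_nat (sqrtX _ q0).
rewrite (_ : _ * _ * _ = (D * Num.sqrt q ^+ n) * (C * Num.sqrt q ^+ n *
  weight n)); last by ring.
by rewrite ler_pM// ?hC// -[n%:R]expr1.
Qed.

Lemma hermite_tame_pred G : hermite_tame G -> hermite_tame (fun n => G n.-1).
Proof.
move=> tG Y q Y0 q1; have q0 : 0 <= q by rewrite ltW// (lt_trans ltr01).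
have [C C0 hC] := tG Y _ Y0 q1; exists C => // -[|n] x xY; first exact: hC.
apply: (le_trans (hC n x xY)); rewrite -!mulrA ler_wpM2l ?(ltW C0)//.
rewrite ler_pM ?exprn_ge0 ?sqrtr_ge0// ?ler_weXn2l ?(ltW q1)//.
apply: ler_wsqrtr; rewrite hermite_weightS ler_peMl ?ltW ?hermite_weight_gt0//.
by rewrite -natrM ltr1n; lia.
Qed.

Lemma hermite_tameZ k G : hermite_tame G -> hermite_tame (fun n x => k * G n x).
Proof.
move=> tG Y q Y0 q1; have [C C0 hC] := tG Y _ Y0 q1.
have k0 : 0 < `|k| + 1 by rewrite ltr_wpDl.
exists ((`|k| + 1) * C) => [|n x xY]; first exact: mulr_gt0.
by rewrite normrM -!mulrA ler_pM// ?lerDl// mulrA; exact: hC.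
Qed.

Lemma hermite_tame_poly : hermite_tame (@hermite_poly R).
Proof. by move=> Y q; exact: hermite_poly_bound. Qed.

Lemma hermite_summable_dom c G Y : hermite_summable c -> hermite_tame G -> 0 <= Y ->
  exists2 b, asummable b & forall i x, `|x| <= Y -> `|c i * G (nu i) x| <= b i.
Proof.
move=> [q q1 cq] tG Y0; have q0 : 0 <= q by rewrite ltW// (lt_trans ltr01).
have [C C0 hC] := tG Y _ Y0 q1.
exists (fun i => C * `|c i * q ^+ nu i * weight (nu i)|).
  by apply: asummableZ; apply: asummable_dom cq => i; rewrite normr_id.
move=> i x xY; rewrite !normrM.
rewrite (ger0_norm (exprn_ge0 _ q0)) (ger0_norm (sqrtr_ge0 _)).
rewrite (_ : C * _ = `|c i| * (C * q ^+ nu i * weight (nu i))); last by ring.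
by rewrite ler_wpM2l ?hC.
Qed.

Lemma hermite_summable_sum c G x : hermite_summable c -> hermite_tame G ->
  asummable (fun i => c i * G (nu i) x).
Proof.
move=> sc tG; have [b sb hb] := hermite_summable_dom sc tG (normr_ge0 x).
by apply: asummable_dom sb => i; rewrite (le_trans (hb _ _ (lexx _)))// ler_norm.
Qed.

Lemma hermite_summable_natM c : hermite_summable c ->
  hermite_summable (fun i => c i * (nu i)%:R).
Proof.
move=> [q q1 cq]; have q0 : 0 <= q by rewrite ltW// (lt_trans ltr01).
have [D D0 hD] := natX_le_geometric 1 (sqrt_gt1 q1).
exists (Num.sqrt q); first exact: sqrt_gt1.
apply: asummable_dom (asummableZ D cq) => i.
rewrite (sqrtX _ q0) !normrM (gtr0_norm D0) normr_nat.
have sq0 := normr_ge0 (Num.sqrt q ^+ nu i).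
have : (nu i)%:R <= D * `|Num.sqrt q ^+ nu i|.
  by rewrite ger0_norm ?exprn_ge0 ?sqrtr_ge0//; have := hD (nu i); rewrite expr1.
move=> h; rewrite (_ : _ * _ * _ * _ =
  (nu i)%:R * (`|c i| * `|Num.sqrt q ^+ nu i| * `|weight (nu i)|)); last by ring.
rewrite (_ : D * _ = (D * `|Num.sqrt q ^+ nu i|) *
  (`|c i| * `|Num.sqrt q ^+ nu i| * `|weight (nu i)|)); last by ring.
by rewrite ler_wpM2r// !mulr_ge0.
Qed.

(** The difference quotients of the sum vanish. For steps |h| <= 1 they are dominated, by the mean
    value theorem, through a bound on [dG] over |y| <= |x| + 1, so [tannery] applies. *)
Lemma has_sum_derive c G dG : hermite_summable c -> hermite_tame G ->
  hermite_tame dG ->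
  (forall n (x : R), is_derive x (1 : R) (G n) (dG n x)) ->
  (forall x, has_sum (fun i => c i * G (nu i) x) 0) ->
  forall x, has_sum (fun i => c i * dG (nu i) x) 0.
Proof.
move=> sc tG tdG Gd G0 x.
have [s hs] := asummable_has_sum (hermite_summable_sum x sc tdG).
suff s0 : s = 0 by rewrite s0 in hs.
have Y0 : 0 <= `|x| + 1 by rewrite addr_ge0.
have [b sb hb] := hermite_summable_dom sc tdG Y0.
pose quot h i := c i * (h^-1 *: ((G (nu i) \o shift x)
  (h *: (1 : R)) - G (nu i) x)).
have : (fun _ : R => 0 : R) @ 0^' --> s.
  apply: (tannery (a := quot) (al := fun i => c i * dG (nu i) x) sb _ _ _ hs).
  - near=> h => i.
    have h0 : h != 0 by near: h; exact: nbhs_dnbhs_neq.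
    have h1 : `|h| <= 1 by near: h; exact: dnbhs0_le.
    rewrite /quot /= normrM normrZ normfV mulrCA ler_pdivrMl ?normr_gt0//.
    rewrite [h *: 1]mulr1 -normrM.
    suff : `|c i * G (nu i) (h + x) - c i * G (nu i) x| <= b i * `|h + x - x|.
      by rewrite addrK -mulrBr [leRHS]mulrC.
    apply: (@lipschitz_of_derive _ (fun y => c i * G (nu i) y)
      (fun y => c i * dG (nu i) y) (`|x| + 1)).
    + exact: hb.
    + by rewrite lerDl.
    + by rewrite addrC (le_trans (ler_normD _ _))// lerD2l.
  - move=> i; apply: cvgMl_tmp.
    by have [dd <-] := Gd (nu i) x.
  - near=> h.
    have h0 : h != 0 by near: h; exact: nbhs_dnbhs_neq.
    have := has_sumB (G0 (h + x)) (G0 x); rewrite subrr.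
    move=> /(@has_sumZ _ _ h^-1); rewrite mulr0; apply: eq_has_sum => i.
    by rewrite /quot /= [h *: 1]mulr1 /GRing.scale /=; ring.
move=> /(cvg_lim (@norm_hausdorff _ R^o)) <-.
by rewrite lim_cst.
Unshelve. all: by end_near. Qed.

(** Hermite's equation n H = x H' - H'' / 2 with the derivatives written out. *)
Lemma hermite_eigen n x : n%:R * hermite_poly n x =
  x * (2 * n%:R * hermite_poly n.-1 x) -
  2^-1 * (2 * n%:R * (2 * n.-1%:R * hermite_poly n.-2 x)).
Proof.
case: n => [|n]; first by rewrite !(mul0r,mulr0) subr0.
by rewrite hermite_polyS /=; field.
Qed.

Lemma has_sum_number c : hermite_summable c ->
  (forall x, has_sum (fun i => c i * hermite_poly (nu i) x) 0) ->
  forall x, has_sum (fun i => c i * (nu i)%:R * hermite_poly (nu i) x) 0.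
Proof.
move=> sc H0 x; have tH := hermite_tame_poly.
pose dH n (y : R) := 2 * n%:R * hermite_poly n.-1 y.
pose ddH n (y : R) := 2 * n%:R * (2 * n.-1%:R * hermite_poly n.-2 y).
have tdH : hermite_tame dH.
  have := hermite_tameZ 2 (hermite_tame_natM (hermite_tame_pred tH)).
  by rewrite /dH; under eq_fun do under eq_fun do rewrite mulrA.
have tddH : hermite_tame ddH.
  have := hermite_tameZ 2 (hermite_tame_natM (hermite_tame_pred tdH)).
  by rewrite /ddH /dH; under eq_fun do under eq_fun do rewrite mulrA.
have dd1 : forall y, has_sum (fun i => c i * dH (nu i) y) 0.
  by apply: has_sum_derive H0 => // n y; exact: is_derive_hermite_poly.
have dd2 : forall y, has_sum (fun i => c i * ddH (nu i) y) 0.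
  apply: has_sum_derive dd1 => // n y; rewrite /dH /ddH.
  by apply: is_derive_eq; [apply: is_deriveZ; exact: is_derive_hermite_poly|].
have := has_sumB (@has_sumZ _ _ x _ _ (dd1 x)) (@has_sumZ _ _ 2^-1 _ _ (dd2 x)).
rewrite !mulr0 subr0; apply: eq_has_sum => i.
by rewrite -mulrA hermite_eigen /dH /ddH; ring.
Qed.

Lemma has_sum_numberX c j : hermite_summable c ->
  (forall x, has_sum (fun i => c i * hermite_poly (nu i) x) 0) ->
  forall x, has_sum (fun i => c i * hermite_poly (nu i) x * (nu i)%:R ^+ j) 0.
Proof.
elim: j c => [|j IH] c sc H0 x.
  by have := H0 x; apply: eq_has_sum => i; rewrite expr0 mulr1.
have := IH _ (hermite_summable_natM sc) (has_sum_number sc H0) x.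
by apply: eq_has_sum => i; rewrite exprS; ring.
Qed.

Lemma has_sum_sumn (a : nat -> I -> R) (s : nat -> R) K :
  (forall k, has_sum (a k) (s k)) ->
  has_sum (fun i => \sum_(k < K) a k i) (\sum_(k < K) s k).
Proof.
move=> as_; elim: K => [|K IH].
  by rewrite big_ord0; apply: eq_has_sum (@has_sum0 R I) => i; rewrite big_ord0.
rewrite big_ord_recr; apply: eq_has_sum (has_sumD IH (as_ K)) => i.
by rewrite big_ord_recr.
Qed.

Arguments has_sum_sumn : clear implicits.

(* By the power series of the exponential and dominated convergence. *)
Lemma has_sum_exp_moment (s : I -> R) q t : 0 <= t -> expR t < q ->
  asummable (fun i => s i * q ^+ nu i) ->
  (forall j, has_sum (fun i => s i * (nu i)%:R ^+ j) 0) ->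
  forall j, has_sum (fun i => s i * expR (- t) ^+ nu i * (nu i)%:R ^+ j) 0.
Proof.
move=> t0 tq sq s0 j; have e1 : 1 <= expR t by rewrite -[1]expR0 ler_expR.
have q0 : 0 < q by rewrite (lt_trans _ tq)// expR_gt0.
(* The partial sums of the series of exp(- t n) are dominated only by exp(t n); the gap between
   exp(t) and q then absorbs n^j. *)
have r1 : 1 < q / expR t by rewrite ltr_pdivlMr ?expR_gt0// mul1r.
have [D D0 hD] := natX_le_geometric j r1.
have sD : asummable (fun i => D * (s i * q ^+ nu i)) by exact: asummableZ.
have bnd i : `|s i * (nu i)%:R ^+ j| * expR t ^+ nu i <= `|D * (s i * q ^+ nu i)|.
  rewrite !normrM (ger0_norm (exprn_ge0 _ (ler0n _ _))) (gtr0_norm D0).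
  rewrite (ger0_norm (exprn_ge0 _ (ltW q0))) mulrCA -mulrA ler_wpM2l//.
  have := hD (nu i); rewrite expr_div_n mulrA ler_pdivlMr// exprn_gt0//.
  exact: expR_gt0.
have sexp : asummable (fun i => s i * expR (- t) ^+ nu i * (nu i)%:R ^+ j).
  apply: asummable_dom sD => i; apply: le_trans (bnd i).
  rewrite mulrAC normrM ler_wpM2l// ger0_norm ?exprn_ge0 ?expR_ge0//.
  by rewrite lerXn2r ?nnegrE ?expR_ge0// ler_expR; lra.
have [S hS] := asummable_has_sum sexp.
suff S0 : S = 0 by rewrite S0 in hS.
pose part K i := \sum_(k < K) (s i * (nu i)%:R ^+ j * exp_coeff (- (t *
  (nu i)%:R)) k).
have : (fun _ : nat => 0 : R) @ \oo --> S.
  apply: (@tannery _ _ _ _ _ part (fun i =>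
    s i * expR (- t) ^+ nu i * (nu i)%:R ^+ j)
      (fun i => `|D * (s i * q ^+ nu i)|) _ S _ _ _ _ hS).
  - by apply: asummable_dom sD => i; rewrite normr_id.
  - apply: nearW => K i; apply: le_trans (bnd i).
    rewrite /part -mulr_sumr normrM ler_wpM2l//.
    apply: (le_trans (ler_norm_sum _ _ _)).
    rewrite -expRM_natr.
    apply: le_trans (exp_series_le K (mulr_ge0 t0 (ler0n R (nu i)))).
    apply: ler_sum => k _; rewrite /exp_coeff /= normrM normrX normrN normfV.
    by rewrite normr_nat (ger0_norm (mulr_ge0 t0 (ler0n R (nu i)))).
  - move=> i; rewrite mulrAC /part.
    under eq_fun do rewrite -mulr_sumr.
    apply: cvgMl_tmp; rewrite -expRM_natr mulNr.
    rewrite (_ : (fun K => _) = series (exp_coeff (- (t * (nu i)%:R)))).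
      exact: is_cvg_series_exp_coeff.
    by apply/funext => K; rewrite /series /= big_mkord.
  - apply: nearW => K.
    have h k : has_sum (fun i => s i * (nu i)%:R ^+ j * exp_coeff (- (t *
      (nu i)%:R)) k) 0.
      have := @has_sumZ _ _ ((- t) ^+ k / k`!%:R) _ _ (s0 (j + k)%N).
      rewrite mulr0; apply: eq_has_sum => i.
      by rewrite /exp_coeff /= -mulNr exprMn exprD; ring.
    by have := has_sum_sumn _ _ K h; rewrite big1.
move=> /(cvg_lim (@norm_hausdorff _ R^o)) <-.
by rewrite lim_cst.
Qed.

(* Dividing by [r ^+ (l * n0)] and letting l tend to infinity isolates the indices
   with the least value of nu. *)
Lemma has_sum_fiber (s : I -> R) r : 0 < r < 1 -> asummable s ->
  (forall l, has_sum (fun i => s i * r ^+ (l * nu i)) 0) ->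
  forall n, has_sum (fun i => if nu i == n then s i else 0) 0.
Proof.
move=> /andP[r0 r1] ss s0.
elim/ltn_ind => n IH.
(* By induction the fibres over k < n sum to 0, so they can be subtracted before dividing by r^(l
   n). *)
have tail0 l : has_sum (fun i => if (n <= nu i)%N then s i * r ^+ (l *
  (nu i - n)) else 0) 0.
  have h k : has_sum (fun i => if (k < n)%N && (nu i == k) then s i * r ^+ (l *
    k) else 0) 0.
    have [kn|nk] /= := ltnP k n; last exact: has_sum0.
    have := @has_sumZ _ _ (r ^+ (l * k)) _ _ (IH k kn); rewrite mulr0.
    by apply: eq_has_sum => i; case: ifP => _; rewrite ?mulr0// mulrC.
  have := has_sumB (s0 l) (has_sum_sumn _ _ n h); rewrite big1// subrr.
  move=> /(@has_sumZ _ _ (r ^+ (l * n))^-1); rewrite mulr0; apply: eq_has_sum => i.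
  have [ni|ni] := leqP n (nu i).
    rewrite big1 => [|k _]; last by rewrite gtn_eqF ?andbF// (leq_trans _ ni).
    rewrite subr0 -[in LHS](subnK ni) mulnDr exprD; field.
    by rewrite expf_neq0// gt_eqF.
  rewrite (bigD1 (Ordinal ni))//= ni eqxx big1 ?addr0 ?subrr ?mulr0// => k.
  by rewrite -val_eqE /= eq_sym => /negbTE ->; rewrite andbF.
have sfib : asummable (fun i => if nu i == n then s i else 0).
  by apply: asummable_dom ss => i; case: ifP; rewrite ?normr0.
have [S hS] := asummable_has_sum sfib.
suff S0 : S = 0 by rewrite S0 in hS.
have : (fun _ : nat => 0 : R) @ \oo --> S.
  apply: (@tannery _ _ _ _ _ (fun l i => if (n <= nu i)%N then s i * r ^+ (l *
    (nu i - n)) else 0)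
    (fun i => if nu i == n then s i else 0) (fun i => `|s i|) _ S _ _ _ _ hS).
  - by apply: asummable_dom ss => i; rewrite normr_id.
  - apply: nearW => l i; case: ifP => _; rewrite ?normr0// normrM ler_piMr//.
    by rewrite ger0_norm ?exprn_ge0 ?exprn_ile1// ltW.
  - move=> i; case: (ltngtP n (nu i)) => [ni|_|<-]; last 2 first.
    + exact: cvg_cst.
    + by rewrite subnn; under eq_fun do rewrite muln0 expr0 mulr1; exact: cvg_cst.
    rewrite -[X in _ --> X](mulr0 (s i)); apply: cvgMl_tmp.
    under eq_fun do rewrite mulnC exprM.
    apply: cvg_expr; rewrite ger0_norm ?exprn_ge0 ?ltW// exprn_ilt1 ?ltW//.
    by rewrite -lt0n subn_gt0.
  - by apply: nearW => l; exact: tail0.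
move=> /(cvg_lim (@norm_hausdorff _ R^o)) <-.
by rewrite lim_cst.
Qed.

Lemma hermite_fiber_sum c : hermite_summable c ->
  (forall x, has_sum (fun i => c i * hermite_poly (nu i) x) 0) ->
  forall n x, has_sum (fun i => if nu i == n then c i *
    hermite_poly (nu i) x else 0) 0.
Proof.
move=> sc H0 n x; have mom j := @has_sum_numberX c j sc H0 x.
have [q q1 cq] := sc; have q0 : 0 <= q by rewrite ltW// (lt_trans ltr01).
have [C C0 hC] := hermite_tame_poly (normr_ge0 x) (sqrt_gt1 q1).
pose s i := c i * hermite_poly (nu i) x.
have sq : asummable (fun i => s i * Num.sqrt q ^+ nu i).
  apply: asummable_dom (asummableZ C cq) => i.
  rewrite (sqrtX _ q0) /s !normrM (gtr0_norm C0).
  rewrite (_ : C * _ = `|c i| * (C * `|Num.sqrt q ^+ nu i| * `|weight (nu i)|) *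
    `|Num.sqrt q ^+ nu i|); last by ring.
  rewrite ler_wpM2r// ler_wpM2l//.
  rewrite (ger0_norm (exprn_ge0 _ (sqrtr_ge0 _))) (ger0_norm (sqrtr_ge0 _)).
  exact: hC.
pose t := ln (Num.sqrt q) / 2.
have sq1 := sqrt_gt1 q1; have lq0 : 0 < ln (Num.sqrt q) by rewrite ln_gt0.
have t0 : 0 < t by rewrite divr_gt0.
have tq : expR t < Num.sqrt q.
  rewrite -[ltRHS]lnK ?posrE ?(lt_trans ltr01)// ltr_expR /t; lra.
apply: (@has_sum_fiber s (expR (- t))).
- by rewrite expR_gt0 expR_lt1 oppr_lt0.
- have := @asummable_dom R I s _ _ sq; apply => i.
  rewrite [leRHS]normrM ler_peMr// (ger0_norm (exprn_ge0 _ (sqrtr_ge0 _))).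
  by rewrite exprn_ege1// ltW.
(* One application of [has_sum_exp_moment] reaches only t with exp(t) < sqrt q. Carrying summability
   with the weight sqrt q and all moments through the induction allows it to be repeated. *)
- suff H l : asummable (fun i => s i * expR (- t) ^+ (l * nu i) *
  Num.sqrt q ^+ nu i) /\
      forall j, has_sum (fun i => s i * expR (- t) ^+ (l * nu i) *
        (nu i)%:R ^+ j) 0.
    move=> l; have [_ /(_ 0%N)] := H l.
    by apply: eq_has_sum => i; rewrite expr0 mulr1.
  elim: l => [|l [IH1 IH2]].
    split; first by under eq_fun do rewrite mul0n expr0 mulr1.
    by move=> j; have := mom j; apply: eq_has_sum => i; rewrite mul0n expr0 mulr1.
  split; last first.
    move=> j; have := has_sum_exp_moment (ltW t0) tq IH1 IH2 j.
    by apply: eq_has_sum => i; rewrite mulSn exprD; ring.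
  apply: asummable_dom IH1 => i; rewrite mulSn exprD.
  rewrite (_ : s i * _ * _ = expR (- t) ^+ nu i * (s i * expR (- t) ^+ (l *
    nu i) * Num.sqrt q ^+ nu i)); last by ring.
  rewrite normrM ler_piMl// ger0_norm ?exprn_ge0 ?expR_ge0//.
  by rewrite exprn_ile1 ?expR_ge0// -[leRHS]expR0 ler_expR oppr_le0 ltW.
Qed.

End hermite_families.

(** * Mehler's formula *)

Section power_series.
Variable R : realType.
Implicit Types (c e : nat -> R) (z l m k : R).

(** Radius of convergence at least 1, in a form that passes easily to the formal derivative. *)
Definition subexponential c := forall Q, 1 < Q -> exists2 C, 0 < C &
  forall n, `|c n| <= C * Q ^+ n.

Lemma subexponential_diffs c : subexponential c -> subexponential (pseries_diffs c).
Proof.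
move=> sc Q Q1; have q1 := sqrt_gt1 Q1.
have Q0 : 0 < Q by rewrite (lt_trans ltr01).
have [C C0 hC] := sc _ q1; have [D D0 hD] := natX_le_geometric 1 q1.
exists (D * C * Q) => [|n]; first by rewrite !mulr_gt0.
rewrite normrM normr_nat.
apply: (@le_trans _ _ ((D * Num.sqrt Q ^+ n.+1) * (C * Num.sqrt Q ^+ n.+1))).
  by rewrite ler_pM//; have := hD n.+1; rewrite expr1.
rewrite (_ : _ * _ = D * C * (Num.sqrt Q ^+ n.+1 * Num.sqrt Q ^+ n.+1));
  last by ring.
by rewrite -(sqrtX _ (ltW Q0)) exprS !mulrA.
Qed.

Lemma subexponential_cvg c z : subexponential c -> `|z| < 1 -> cvgn (pseries c z).
Proof.
move=> sc z1; have d0 : 0 < 1 + `|z| by rewrite ltr_pwDl.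
(* The inverse of the midpoint of |z| and 1, hence Q > 1 and Q |z| < 1. *)
pose Q := 2 / (1 + `|z|).
have Q1 : 1 < Q by rewrite ltr_pdivlMr// mul1r; lra.
have Q0 : 0 < Q by rewrite (lt_trans ltr01).
have Qz : `|Q * `|z| | < 1.
  rewrite ger0_norm ?mulr_ge0 ?(ltW Q0)// /Q mulrAC ltr_pdivrMr//; lra.
have [C C0 hC] := sc _ Q1.
apply: normed_cvg; rewrite /normed_series_of.
apply: (@series_le_cvg _ _ (geometric C (Q * `|z|))) => [n|n|n|].
- exact: normr_ge0.
- by rewrite /geometric /= mulr_ge0 ?(ltW C0)// exprn_ge0// mulr_ge0// ltW.
- by rewrite /= normrM normrX exprMn mulrA ler_wpM2r ?exprn_ge0.
- exact: is_cvg_geometric_series.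
Qed.

Lemma is_derive_pseries c z : subexponential c -> `|z| < 1 ->
  is_derive z 1 (fun z => limn (pseries c z)) (limn (pseries (pseries_diffs c) z)).
Proof.
move=> sc z1; have sc1 := subexponential_diffs sc.
(* Termwise differentiation at z asks for convergence at a point of larger modulus; the midpoint of
   |z| and 1 is one. *)
have K1 : `|(1 + `|z|) / 2| < 1.
  by rewrite ger0_norm ?divr_ge0 ?addr_ge0// ltr_pdivrMr//; lra.
apply: (@pseries_snd_diffs _ c ((1 + `|z|) / 2));
  [exact: subexponential_cvg|exact: subexponential_cvg|..].
  exact: subexponential_cvg (subexponential_diffs sc1) K1.
by rewrite [ltRHS]ger0_norm ?divr_ge0 ?addr_ge0// ltr_pdivlMr//; lra.
Qed.

Definition pseries_to c z l := pseries c z @ \oo --> l.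

Lemma pseries_toD c e z l m : pseries_to c z l -> pseries_to e z m ->
  pseries_to (fun n => c n + e n) z (l + m).
Proof.
move=> cl em; rewrite /pseries_to (_ : pseries _ z = pseries c z \+ pseries e z).
  exact: cvgD.
apply/funext => N; rewrite /pseries /series /= -big_split.
by apply: eq_bigr => n _; rewrite mulrDl.
Qed.

Lemma pseries_toZ k c z l : pseries_to c z l ->
  pseries_to (fun n => k * c n) z (k * l).
Proof.
move=> cl; rewrite /pseries_to (_ : pseries _ z = (fun N => k * pseries c z N)).
  exact: cvgMl_tmp.
apply/funext => N; rewrite /pseries /series /= mulr_sumr.
by apply: eq_bigr => n _; rewrite mulrA.
Qed.

Arguments pseries_toZ k [c z l] _.

Definition pseries_shift c n := if n is m.+1 then c m else 0.

Lemma pseries_to_shift c z l : pseries_to c z l ->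
  pseries_to (pseries_shift c) z (z * l).
Proof.
move=> cl; rewrite /pseries_to -cvg_shiftS.
rewrite (_ : (fun N => _) = (fun N => z * pseries c z N)); first exact: cvgMl_tmp.
apply/funext => N; rewrite /pseries /series /= big_nat_recl//= mul0r add0r.
by rewrite mulr_sumr; apply: eq_bigr => n _; rewrite exprS; ring.
Qed.

Lemma pseries0 c : pseries_to c 0 (c 0).
Proof.
rewrite /pseries_to -cvg_shiftS (_ : (fun N => _) = cst (c 0));
  first exact: cvg_cst.
apply/funext => N; rewrite /pseries /series /= big_nat_recl//= expr0 mulr1.
by rewrite big1 ?addr0// => n _; rewrite exprS mul0r mulr0.
Qed.

End power_series.
Arguments pseries_toZ {R} k [c z l] _.

Section mehler.
Variables (R : realType) (x y : R).
Implicit Types (z q : R).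

Let a n : R := hermite_poly n x * hermite_poly n y / hermite_weight R n.

(** From 2 |AB| <= A^2 + B^2 and the growth of the squares, with one constant on an interval
    containing both x and y. *)
Lemma mehler_subexponential : subexponential a.
Proof.
move=> Q Q1; have Y0 : 0 <= `|x| + `|y| by rewrite addr_ge0.
have [C C0 hC] := hermite_poly_growth Y0 Q1; exists C => // n.
have W0 := @hermite_weight_gt0 R n.
rewrite /a normrM normfV (gtr0_norm W0) ler_pdivrMr//.
have hx := hC n x; have hy := hC n y.
have {}hx : hermite_poly n x ^+ 2 <= C * Q ^+ n * hermite_weight R n.
  by apply: hx; rewrite lerDl.
have {}hy : hermite_poly n y ^+ 2 <= C * Q ^+ n * hermite_weight R n.
  by apply: hy; rewrite lerDr.
have sub := sqr_ge0 (hermite_poly n x - hermite_poly n y).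
have add := sqr_ge0 (hermite_poly n x + hermite_poly n y).
by rewrite ler_norml; apply/andP; split; nra.
Qed.

Let D := pseries_diffs a.
Let S := @pseries_shift R.

(* The ODE [mehler_ode] for [sum a_n z^n], read off coefficientwise. *)
Lemma mehler_recurrence n :
  D n + - 2 * S (S D) n + S (S (S (S D))) n =
  S a n + - 1 * S (S (S a)) n + 2 * x * y * (a n + S (S a) n) +
  - 2 * (x ^+ 2 + y ^+ 2) * S a n.
Proof.
case: n => [|[|[|k]]].
- rewrite /D /S /a /pseries_diffs /pseries_shift /=.
  by rewrite !hermite_weightS hermite_weight0; field.
- rewrite /D /S /a /pseries_diffs /pseries_shift /=.
  by rewrite !hermite_weightS hermite_weight0; field.
- rewrite /D /S /a /pseries_diffs /pseries_shift /=.
  by rewrite !hermite_weightS hermite_weight0; field.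
(* Four shifts leave the coefficient k - 1 of [D], which is k a_k; for k = 0 both sides are 0. *)
have -> : S (S (S (S D))) k.+3 = k%:R * a k.
  by case: k => [|k]; rewrite ?mul0r.
rewrite /D /S /pseries_diffs /= /a.
rewrite !hermite_polyS /= !hermite_weightS.
have W0 := @hermite_weight_gt0 R k.
move: (hermite_poly k x) (hermite_poly k.-1 x) (hermite_poly k y)
  (hermite_poly k.-1 y).
move: (hermite_weight R k) W0 => W W0 A A' B B'.
rewrite -!natr1; have k0 : 0 <= k%:R :> R by [].
move: (k%:R : R) k0 => kr k0.
field; rewrite !gt_eqF//; lra.
Qed.

Let F z := limn (pseries a z).

(** The coefficient of [F z] is the logarithmic derivative of Mehler's closed form, cleared of the
    denominator (1 - z^2)^2. *)
Lemma mehler_ode z : `|z| < 1 ->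
  (1 - z ^+ 2) ^+ 2 * limn (pseries D z) =
  (z * (1 - z ^+ 2) + 2 * x * y * (1 + z ^+ 2) - 2 * z * (x ^+ 2 + y ^+ 2)) * F z.
Proof.
move=> z1; have sa := mehler_subexponential.
have aF : pseries_to a z (F z) by exact: subexponential_cvg.
have DF : pseries_to D z (limn (pseries D z)).
  by apply: subexponential_cvg => //; exact: subexponential_diffs.
have sh c l : pseries_to c z l -> pseries_to (S c) z (z *
  l) by exact: pseries_to_shift.
have lhs := pseries_toD (pseries_toD DF (pseries_toZ (-2) (sh _ _ (sh _ _ DF))))
  (sh _ _ (sh _ _ (sh _ _ (sh _ _ DF)))).
have rhs := pseries_toD (pseries_toD (pseries_toD (sh _ _ aF)
    (pseries_toZ (-1) (sh _ _ (sh _ _ (sh _ _ aF)))))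
    (pseries_toZ (2 * x * y) (pseries_toD aF (sh _ _ (sh _ _ aF)))))
    (pseries_toZ (-2 * (x ^+ 2 + y ^+ 2)) (sh _ _ aF)).
rewrite (funext mehler_recurrence) in lhs.
have E := cvg_unique (@norm_hausdorff _ R^o) lhs rhs.
transitivity (limn (pseries D z) + -2 * (z * (z * limn (pseries D z))) +
  z * (z * (z * (z * limn (pseries D z))))); first by ring.
by rewrite E; ring.
Qed.

Let E z := (2 * x * y * z - z ^+ 2 * (x ^+ 2 + y ^+ 2)) / (1 - z ^+ 2).
(** The reciprocal of the expected closed form, with its square root written through [ln] for
    differentiation; the formula thus says that F L is constantly 1. *)
Let L z := expR (2^-1 * ln (1 - z ^+ 2) - E z).

Lemma is_derive_mehler z : `|z| < 1 -> is_derive z 1 (fun z => F z * L z) 0.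
Proof.
move=> z1; have dF := is_derive_pseries mehler_subexponential z1.
have z2 : 0 < 1 - z ^+ 2.
  by rewrite subr_gt0 -real_normK ?num_real// expr_lt1.
have z2n : 1 - z ^+ 2 != 0 by rewrite gt_eqF.
have dln := is_derive1_ln z2.
have dL : is_derive z 1 L (L z * (- z / (1 - z ^+ 2) -
    (2 * x * y * (1 + z ^+ 2) - 2 * z * (x ^+ 2 + y ^+ 2)) / (1 - z ^+ 2) ^+ 2)).
  rewrite /L /E.
  apply: is_derive_eq.
  by rewrite /GRing.scale /=; field.
have dF' : is_derive z 1 F (limn (pseries D z)) by exact: dF.
have ode := mehler_ode z1.
have DE : limn (pseries D z) = (z * (1 - z ^+ 2) + 2 * x * y * (1 + z ^+ 2) -
    2 * z * (x ^+ 2 + y ^+ 2)) * F z / (1 - z ^+ 2) ^+ 2.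
  by rewrite -ode mulrC mulKf// expf_neq0.
rewrite DE in dF'.
have [dFL vFL] := is_deriveM dF' dL.
apply: DeriveDef; first exact: dFL.
by rewrite [LHS]vFL /GRing.scale /=; field.
Qed.

Lemma mehler q : 0 <= q < 1 ->
  pseries_to a q ((Num.sqrt (1 - q ^+ 2))^-1 *
    expR ((2 * x * y * q - q ^+ 2 * (x ^+ 2 + y ^+ 2)) / (1 - q ^+ 2))).
Proof.
move=> /andP[q0 q1]; have sa := mehler_subexponential.
have aF : pseries_to a q (F q) by apply: subexponential_cvg => //;
  rewrite ger0_norm.
suff <- : F q = (Num.sqrt (1 - q ^+ 2))^-1 *
    expR ((2 * x * y * q - q ^+ 2 * (x ^+ 2 + y ^+ 2)) / (1 - q ^+ 2)) by [].
have der z : 0 <= z <= q -> is_derive z 1 (fun z => F z * L z) 0.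
  by move=> /andP[z0 zq]; apply: is_derive_mehler;
    rewrite ger0_norm// (le_lt_trans zq).
have FL : F q * L q = 1.
  have F0 : F 0 = 1.
    have : pseries_to a 0 (a 0) by exact: pseries0.
    by move=> /(cvg_lim (@norm_hausdorff _ R^o)) h;
      rewrite /F h /a /= hermite_weight0 !mul1r invr1.
  have cFL : {within `[0, q], continuous (fun z => F z * L z)}.
    apply: derivable_within_continuous => z; rewrite in_itv/= => zq.
    by have [] := der z zq.
  have dFL z : z \in `]0, q[ -> is_derive z 1 (fun z => F z * L z) 0.
    by rewrite in_itv/= => /andP[z0 zq]; apply: der; rewrite !ltW.
  have [c _] := MVT_segment q0 dFL cFL.
  rewrite mul0r F0 mul1r /L /E expr0n/= subr0 ln1 !mulr0 mul0r subr0 mul0r subr0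
    expR0.
  by move=> /eqP; rewrite subr_eq0 => /eqP.
have q2 : 0 < 1 - q ^+ 2 by rewrite subr_gt0 expr_lt1.
have -> : F q = (L q)^-1.
  by apply: (mulIf (x := L q)); rewrite ?FL ?mulVf// gt_eqF// expR_gt0.
rewrite -expRN opprB addrC expRD; congr (_ * _).
by rewrite expRN -powR12_sqrt ?ltW// /powR gt_eqF.
Qed.

End mehler.

(** * Gaussian integrals *)

Section density.
Import HBNNSimple.
Local Open Scope ereal_scope.
Context d (T : measurableType d) (R : realType).
Variables (mu nu : {measure set T -> \bar R}) (g : T -> R).
Hypotheses (g0 : forall x, (0 <= g x)%R) (mg : measurable_fun setT g).
Hypothesis nuE : forall A, measurable A -> nu A = \int[mu]_(x in A) (g x)%:E.

(** Moves integrals against [gauss_measure], which is defined by its density, to Lebesgue measure.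
    Both sides are monotone limits over simple functions. *)
Lemma ge0_integral_density (f : T -> \bar R) :
  (forall x, 0 <= f x) -> measurable_fun setT f ->
  \int[nu]_x f x = \int[mu]_x (f x * (g x)%:E).
Proof.
move=> f0 mf; pose h := nnsfun_approx measurableT mf.
have hf x : (EFin \o h n) x @[n --> \oo] --> f x by exact: cvg_nnsfun_approx.
have ndh x : {homo (fun n => (EFin \o h n) x) : a b / (a <= b)%N >-> a <= b}.
  by move=> a b ab; rewrite lee_fin; exact/lefP/nd_nnsfun_approx.
have -> : \int[nu]_x f x = limn (fun n => \int[nu]_x (EFin \o h n) x).
  under eq_integral do rewrite -(cvg_lim _ (hf _))//.
  apply: monotone_convergence => //; first by move=> n; exact/measurable_EFinP.
  by move=> n x _; rewrite lee_fin.
have -> : \int[mu]_x (f x * (g x)%:E) =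
    limn (fun n => \int[mu]_x ((EFin \o h n) x * (g x)%:E)).
  have hfg x : ((EFin \o h n) x * (g x)%:E) @[n --> \oo] --> f x * (g x)%:E.
    by apply: cvgeZr; [|exact: hf].
  under eq_integral do rewrite -(cvg_lim _ (hfg _))//.
  apply: monotone_convergence => //.
  - by move=> n; apply: emeasurable_funM; exact/measurable_EFinP.
  - by move=> n x _; rewrite mule_ge0// lee_fin.
  - by move=> x _ a b ab; rewrite lee_wpmul2r ?lee_fin//; exact: ndh.
congr (limn _); apply/funext => n.
transitivity (\int[mu]_x (\sum_(y \in range (h n))
    (y * \1_(h n @^-1` [set y]) x)%:E * (g x)%:E)); last first.
  apply: eq_integral => x _.
  rewrite -ge0_mule_fsuml => [|y]; last exact: nnfun_muleindic_ge0.
  by rewrite fsumEFin// -fimfunE.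
rewrite integralT_nnsfun sintegralE ge0_integral_fsum//; last 2 first.
  - move=> y; apply: emeasurable_funM; apply/measurable_EFinP => //.
    exact: measurable_funM.
  - by move=> y x _; rewrite mule_ge0 ?lee_fin//; exact: nnfun_muleindic_ge0.
apply: eq_fsbigr => r; rewrite inE => -[t _ rt].
under eq_integral do rewrite EFinM -muleA.
rewrite ge0_integralZl//=.
- congr (_ * _); rewrite nuE//.
  rewrite integral_mkcond; apply: eq_integral => x _.
  by rewrite epatch_indic muleC.
- by apply: emeasurable_funM; apply/measurable_EFinP.
- by move=> x _; rewrite mule_ge0// lee_fin.
- by rewrite lee_fin -rt.
Qed.
End density.

(** * Lebesgue integrals of products of one-variable functions *)

Section lebesgue_rV.
Variable R : realType.

Lemma measurable_coord n (h : R -> R) (k : 'I_n) : measurable_fun setT h ->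
  measurable_fun setT (fun z : borel_rV R n => h ((z : 'rV_n) 0 k)).
Proof.
move=> mh; apply: measurableT_comp => //.
by apply: continuous_measurable_rV; exact: coord_continuous.
Qed.

(** Induction along the construction of the measure: in dimension n + 1 it is the pushforward of a
    product measure, to which Tonelli's theorem applies. *)
Lemma integral_lebesgue_rV_prod n (h : 'I_n -> R -> R) (c : 'I_n -> R) :
  (forall k x, 0 <= h k x) -> (forall k, measurable_fun setT (h k)) ->
  (forall k, \int[lebesgue_measure]_x (h k x)%:E = (c k)%:E)%E ->
  (\int[lebesgue_measure_rV R n]_z (\prod_(k < n) h k ((z : 'rV_n) 0 k))%:E =
  (\prod_(k < n) c k)%:E)%E.
Proof.
have prod_meas m (e : 'I_m -> R -> R) : (forall k, measurable_fun setT (e k)) ->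
    measurable_fun setT (fun z : borel_rV R m =>
      \prod_(k < m) e k ((z : 'rV_m) 0 k)).
  by move=> me; apply: measurable_prod => k _; exact: measurable_coord.
elim: n h c => [|n IH] h c h0 mh hc.
  rewrite integral_dirac//; last by apply/measurable_EFinP; exact: prod_meas.
  by rewrite !big_ord0 mule1 /dirac indicE in_setT.
transitivity (\int[pushforward (@lebesgue_measure R \x lebesgue_measure_rV R n)
    (@cons_rV R n)]_z (\prod_(k < n.+1) h k ((z : 'rV_n.+1) 0 k))%:E)%E;
      first by [].
rewrite ge0_integral_pushforward//=; last 3 first.
- exact: measurable_cons_rV.
- by apply/measurable_EFinP; exact: prod_meas.
- by move=> z _; rewrite lee_fin prodr_ge0.
rewrite preimage_setT.
have mtail : measurable_fun setT (fun w : borel_rV R n =>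
    \prod_(k < n) h (lift ord0 k) ((w : 'rV_n) 0 k)).
  exact: (prod_meas n (fun k => h (lift ord0 k)) (fun k => mh _)).
transitivity (\int[@lebesgue_measure R \x lebesgue_measure_rV R n]_p
    (h ord0 p.1 * \prod_(k < n) h (lift ord0 k) ((p.2 : 'rV_n) 0 k))%:E)%E.
  apply: eq_integral => p _; rewrite /= big_ord_recl; congr (_ * _)%:E.
    rewrite -(cons_rV_lshift p ord0); congr (h _ (_ 0 _)); exact: val_inj.
  apply: eq_bigr => k _; rewrite -(cons_rV_rshift p k).
  by congr (h _ (_ 0 _)); exact: val_inj.
rewrite fubini_tonelli1; last 2 first.
- apply/measurable_EFinP; apply: measurable_funM.
    exact: (measurableT_comp (mh ord0) measurable_fst).
  exact: (measurableT_comp mtail measurable_snd).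
- by move=> p; rewrite lee_fin mulr_ge0// prodr_ge0.
rewrite /fubini_F /=.
under eq_integral => x _.
  under eq_integral do rewrite EFinM.
  rewrite ge0_integralZl_EFin//=; last 2 first.
  - by move=> w _; rewrite lee_fin prodr_ge0.
  - by apply/measurable_EFinP.
  rewrite (IH (fun k => h (lift ord0 k)) (fun k => c (lift ord0 k)))//.
  over.
rewrite /= ge0_integralZr//=; last 3 first.
- by apply/measurable_EFinP; exact: mh.
- by move=> x _; rewrite lee_fin.
- rewrite lee_fin prodr_ge0// => k _.
  by rewrite -lee_fin -hc integral_ge0// => x _; rewrite lee_fin.
by rewrite hc -EFinM big_ord_recl.
Qed.
End lebesgue_rV.

Section gaussian_integral.
Variable R : realType.
Implicit Types (x y z t : R).

Definition gauss_factor z : R := pi `^ (- 2^-1) * expR (- z ^+ 2).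

Lemma gauss_factor_ge0 z : 0 <= gauss_factor z.
Proof. by rewrite mulr_ge0 ?powR_ge0 ?expR_ge0. Qed.

Lemma gauss_densityE d (z : 'rV[R]_d) :
  gauss_density z = \prod_(k < d) gauss_factor (z 0 k).
Proof.
rewrite /gauss_density /gauss_factor big_split /= prodr_const card_ord.
rewrite -sumrN expR_sum -powR_mulrn ?powR_ge0// -powRrM.
by congr (_ `^ _ * _); rewrite mulNr [2^-1 * _]mulrC.
Qed.

Lemma gauss_convolution t x y :
  (\int[lebesgue_measure]_z (expR (- (t ^+ 2 * `|x - z| ^+ 2)) *
    expR (- (t ^+ 2 * `|z - y| ^+ 2)) * gauss_factor z)%:E)%E =
  ((Num.sqrt (1 + 2 * t ^+ 2))^-1 * expR (t ^+ 4 * (x + y) ^+ 2 / (1 + 2 * t ^+ 2) -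
    t ^+ 2 * (x ^+ 2 + y ^+ 2)))%:E.
Proof.
set a := 1 + 2 * t ^+ 2.
have a0 : 0 < a by rewrite ltr_pwDl// mulr_ge0// sqr_ge0.
have an0 : a != 0 by rewrite gt_eqF.
(* Completing the square in z: the integrand is a constant times the normal density of mean [m] and
   variance 1 / (2a). *)
pose s := Num.sqrt ((2 * a)^-1); pose m := t ^+ 2 * (x + y) / a.
have s2 : s ^+ 2 = (2 * a)^-1 by rewrite sqr_sqrtr// invr_ge0 mulr_ge0 ?ltW.
have s0 : s != 0 by rewrite gt_eqF// sqrtr_gt0 invr_gt0 mulr_gt0.
pose C := (Num.sqrt a)^-1 * expR (t ^+ 4 * (x + y) ^+ 2 / a - t ^+ 2 * (x ^+ 2 +
  y ^+ 2)).
have C0 : 0 <= C by rewrite mulr_ge0 ?expR_ge0// invr_ge0.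
have peak : normal_peak s = Num.sqrt a * pi `^ (- 2^-1).
  rewrite /normal_peak s2 powRN powR12_sqrt ?pi_ge0//.
  rewrite (_ : _ *+ 2 = a^-1 * pi); last by rewrite -mulr_natr; field.
  by rewrite sqrtrM ?invr_ge0 ?ltW// sqrtrV ?ltW// invfM invrK.
under eq_integral => z _.
  rewrite (_ : _ * _ * _ = C * normal_pdf m s z).
    rewrite EFinM.
    over.
  rewrite normal_pdfE// peak /normal_fun /gauss_factor /C.
  rewrite !real_normK ?num_real//.
  set A := t ^+ 4 * _ / a - _; set B := - (z - m) ^+ 2 / _.
  transitivity (pi `^ (- 2^-1) * (expR A * expR B)).
    rewrite -!expRD mulrCA -expRD.
    congr (_ * expR _); rewrite /A /B -mulr_natr s2 /m.
    have -> : a = 1 + 2 * t ^+ 2 by [].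
    by field; rewrite -/a.
  have r0 : Num.sqrt a != 0 by rewrite gt_eqF// sqrtr_gt0.
  move: (Num.sqrt a) (expR A) (expR B) r0 => r eA eB r0.
  by field.
rewrite ge0_integralZl_EFin//; last 2 first.
- by move=> z _; rewrite lee_fin normal_pdf_ge0.
- by apply/measurable_EFinP; exact: measurable_normal_pdf.
by rewrite integral_normal_pdf mule1.
Qed.

End gaussian_integral.

(** * The eigenfunctions *)

Section eigenfunction.
Variable R : realType.
Implicit Types (t x y Y z : R) (n : nat).

Definition gk_beta t : R := (1 + 4 * t ^+ 2) `^ 4^-1.

Definition gk_phi1 t n x : R := gk_rho t n.+1 * gk_e t n.+1 x.

Definition gk_coef t n : R :=
  (1 - gk_w t) * Num.sqrt (gk_beta t) * gk_w t ^+ n / Num.sqrt (hermite_weight R n).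

Lemma gk_root_gt1 t : 0 < t -> 1 < Num.sqrt (1 + 4 * t ^+ 2).
Proof. by move=> t0; apply: sqrt_gt1; rewrite ltrDl mulr_gt0// exprn_gt0. Qed.

Lemma gk_root_sqr t : Num.sqrt (1 + 4 * t ^+ 2) ^+ 2 = 1 + 4 * t ^+ 2.
Proof. by rewrite sqr_sqrtr// addr_ge0// mulr_ge0// sqr_ge0. Qed.

Lemma gk_beta_gt0 t : 0 < gk_beta t.
Proof. by rewrite powR_gt0// ltr_pwDl// mulr_ge0// sqr_ge0. Qed.

Lemma gk_beta_sqr t : gk_beta t ^+ 2 = Num.sqrt (1 + 4 * t ^+ 2).
Proof.
have h : 0 <= 1 + 4 * t ^+ 2 by rewrite addr_ge0// mulr_ge0// sqr_ge0.
rewrite -powR12_sqrt// /gk_beta -powR_mulrn ?powR_ge0// -powRrM.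
by congr (_ `^ _); field.
Qed.

(** With s = sqrt(1 + 4 t^2) the parameters become rational in s: w = (s - 1) / (s + 1), u = (s - 1)
    / 2, beta^2 = s and t^2 = (s^2 - 1) / 4. The identities behind [gk_mehler] then reduce to field
    computations. *)
Lemma gk_wE t : 0 < t ->
  gk_w t = (Num.sqrt (1 + 4 * t ^+ 2) - 1) / (Num.sqrt (1 + 4 * t ^+ 2) + 1).
Proof.
move=> t0; have s1 := gk_root_gt1 t0; have s2 := gk_root_sqr t; rewrite /gk_w.
move: (Num.sqrt _) s1 s2 => s s1 s2.
have -> : t ^+ 2 = (s ^+ 2 - 1) / 4 by rewrite s2; field.
field; apply/andP; split; rewrite gt_eqF//; first by lra.
by nra.
Qed.

Lemma gk_uE t : 0 < t -> gk_u t = (Num.sqrt (1 + 4 * t ^+ 2) - 1) / 2.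
Proof.
move=> t0; have s1 := gk_root_gt1 t0; have s2 := gk_root_sqr t; rewrite /gk_u.
move: (Num.sqrt _) s1 s2 => s s1 s2.
have -> : t ^+ 2 = (s ^+ 2 - 1) / 4 by rewrite s2; field.
by field; rewrite gt_eqF//; lra.
Qed.

Lemma gk_w_itv t : 0 < t -> 0 < gk_w t < 1.
Proof.
move=> t0; have := gk_root_gt1 t0; rewrite gk_wE//.
move: (Num.sqrt _) => s s1; rewrite divr_gt0 ?subr_gt0//; last by lra.
by rewrite ltr_pdivrMr ?mul1r; lra.
Qed.

Lemma gk_phi1E t n x : gk_phi1 t n x =
  expR (- (gk_u t * x ^+ 2)) * (gk_coef t n * hermite_poly n (gk_beta t * x)).
Proof.
rewrite /gk_phi1 /gk_rho /gk_e /= hermiteE -/(gk_beta t) -/(hermite_weight R n).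
rewrite /gk_coef sqrtrM ?(ltW (gk_beta_gt0 t))// sqrtrV ?(ltW (hermite_weight_gt0
  R n))//.
ring.
Qed.

Lemma gk_coef_bound t : 0 < t -> exists q r, [/\ 1 < q, 0 <= r < 1 &
  forall n, gk_coef t n * q ^+ n * Num.sqrt (hermite_weight R n) =
    (1 - gk_w t) * Num.sqrt (gk_beta t) * r ^+ n].
Proof.
move=> t0; have /andP[w0 w1] := gk_w_itv t0.
have d0 : 0 < 1 + gk_w t by lra.
(* The inverse of the midpoint of w and 1: q > 1 while r = q w < 1. *)
exists (2 / (1 + gk_w t)), (2 / (1 + gk_w t) * gk_w t); split.
- by rewrite ltr_pdivlMr//; lra.
- apply/andP; split; first exact: (mulr_ge0 (divr_ge0 (ler0n _ 2) (ltW d0))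
  (ltW w0)).
  by rewrite mulrAC ltr_pdivrMr//; lra.
- move=> n; rewrite /gk_coef; move: (2 / _) => q.
  rewrite [(q * _) ^+ n]exprMn.
  have W0 : Num.sqrt (hermite_weight R n) != 0.
    by rewrite gt_eqF// sqrtr_gt0 hermite_weight_gt0.
  move: (Num.sqrt (hermite_weight R n)) W0 => W W0.
  by field.
Qed.

(** The Gaussian factor is at most 1 since u >= 0. Constant and ratio are paired so that [choice]
    picks them for all coordinates together. *)
Lemma gk_phi1_bound t Y : 0 < t -> 0 <= Y -> exists Cr : R * R,
  [/\ 0 <= Cr.1, 0 <= Cr.2 < 1 &
      forall n x, `|x| <= Y -> `|gk_phi1 t n x| <= Cr.1 * Cr.2 ^+ n].
Proof.
move=> t0 Y0; have [q [r [q1 r01 hr]]] := gk_coef_bound t0.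
have /andP[w0 w1] := gk_w_itv t0; have b0 := gk_beta_gt0 t.
have s1 := gk_root_gt1 t0.
have [C C0 hC] := hermite_poly_bound (mulr_ge0 (ltW b0) Y0) q1.
exists (C * ((1 - gk_w t) * Num.sqrt (gk_beta t)), r); split => //=.
  by rewrite mulr_ge0 ?(ltW C0)// mulr_ge0// ?sqrtr_ge0//; lra.
move=> n x xY; rewrite gk_phi1E normrM ger0_norm ?expR_ge0//.
have c0 : 0 <= gk_coef t n.
  rewrite /gk_coef divr_ge0// mulr_ge0 ?exprn_ge0 ?ltW//.
  by rewrite mulr_gt0 ?subr_gt0// sqrtr_gt0.
apply: (@le_trans _ _ (gk_coef t n * (C * q ^+ n * Num.sqrt (hermite_weight R n)))).
  rewrite -[leRHS]mul1r ler_pM//.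
    rewrite -expR0 ler_expR oppr_le0 mulr_ge0 ?sqr_ge0// gk_uE//.
    by rewrite divr_ge0// subr_ge0 ltW.
  rewrite normrM (ger0_norm c0) ler_wpM2l// hC// normrM (gtr0_norm b0).
  by rewrite ler_wpM2l// ltW.
rewrite (_ : gk_coef t n * _ =
  C * (gk_coef t n * q ^+ n * Num.sqrt (hermite_weight R n))); last by ring.
by rewrite hr !mulrA.
Qed.

(** Mehler's formula at q = w^2, as each of the two factors carries w^n; the limit is exactly the
    value found in [gauss_convolution]. *)
Lemma gk_mehler t x y : 0 < t ->
  (fun N => \sum_(n < N) gk_phi1 t n x * gk_phi1 t n y) @ \oo -->
  (Num.sqrt (1 + 2 * t ^+ 2))^-1 * expR (t ^+ 4 * (x + y) ^+ 2 / (1 + 2 * t ^+ 2) -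
    t ^+ 2 * (x ^+ 2 + y ^+ 2)).
Proof.
move=> t0; have /andP[w0 w1] := gk_w_itv t0; have b0 := gk_beta_gt0 t.
have q01 : 0 <= gk_w t ^+ 2 < 1 by rewrite exprn_ge0 ?ltW//= expr_lt1 ?ltW.
have sb2 := sqr_sqrtr (ltW b0); set sb := Num.sqrt (gk_beta t) in sb2.
pose c := (1 - gk_w t) ^+ 2 * sb ^+ 2 * expR (- (gk_u t * (x ^+ 2 + y ^+ 2))).
have := cvgMl_tmp (a := c) (@mehler R (gk_beta t * x) (gk_beta t * y) _ q01).
have -> : (fun N => c * pseries (fun n => hermite_poly n (gk_beta t * x) *
    hermite_poly n (gk_beta t * y) / hermite_weight R n) (gk_w t ^+ 2) N) =
    (fun N => \sum_(n < N) gk_phi1 t n x * gk_phi1 t n y).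
  apply/funext => N; rewrite /pseries /series /= big_mkord mulr_sumr.
  apply: eq_bigr => n _; rewrite !gk_phi1E /c /gk_coef mulrDr opprD expRD -/sb.
  have -> : (hermite_weight R n)^-1 =
      (Num.sqrt (hermite_weight R n))^-1 * (Num.sqrt (hermite_weight R n))^-1.
    by rewrite -invfM -expr2 sqr_sqrtr// ltW// hermite_weight_gt0.
  by rewrite exprAC expr2; ring.
have s1 := gk_root_gt1 t0; have s2 := gk_root_sqr t; have b2 := gk_beta_sqr t.
have wE := gk_wE t0; have uE := gk_uE t0.
set s := Num.sqrt (1 + 4 * t ^+ 2) in s1 s2 b2 wE uE.
have t2 : t ^+ 2 = (s ^+ 2 - 1) / 4 by rewrite s2; field.
have a0 : 0 < 1 + 2 * t ^+ 2 by rewrite ltr_pwDl// mulr_ge0// sqr_ge0.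
have sn0 : s + 1 != 0 by rewrite gt_eqF//; lra.
(* Both sides have the square 8 s (s^2 + 1) / (s + 1)^4. *)
have sq : Num.sqrt (1 - (gk_w t ^+ 2) ^+ 2) =
    (1 - gk_w t) ^+ 2 * gk_beta t * Num.sqrt (1 + 2 * t ^+ 2).
  rewrite -[RHS]ger0_norm; last first.
    by rewrite mulr_ge0 ?sqrtr_ge0// mulr_ge0 ?sqr_ge0// ltW.
  rewrite -sqrtr_sqr; congr Num.sqrt.
  by rewrite wE !exprMn b2 sqr_sqrtr ?(ltW a0)// t2; field.
have -> : c * ((Num.sqrt (1 - (gk_w t ^+ 2) ^+ 2))^-1 *
    expR ((2 * (gk_beta t * x) * (gk_beta t * y) *
      gk_w t ^+ 2 - (gk_w t ^+ 2) ^+ 2 *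
      ((gk_beta t * x) ^+ 2 + (gk_beta t * y) ^+ 2)) / (1 - (gk_w t ^+ 2) ^+ 2))) =
   (Num.sqrt (1 + 2 * t ^+ 2))^-1 * expR (t ^+ 4 * (x + y) ^+ 2 / (1 + 2 * t ^+ 2) -
    t ^+ 2 * (x ^+ 2 + y ^+ 2)); last by apply.
rewrite sq /c sb2.
transitivity ((Num.sqrt (1 + 2 * t ^+ 2))^-1 * (expR (- (gk_u t * (x ^+ 2 +
  y ^+ 2))) *
    expR ((2 * (gk_beta t * x) * (gk_beta t * y) *
      gk_w t ^+ 2 - (gk_w t ^+ 2) ^+ 2 *
      ((gk_beta t * x) ^+ 2 + (gk_beta t * y) ^+ 2)) / (1 - (gk_w t ^+ 2) ^+ 2)))).
  have r0 : Num.sqrt (1 + 2 * t ^+ 2) != 0 by rewrite gt_eqF// sqrtr_gt0.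
  have b0' : gk_beta t != 0 by rewrite gt_eqF.
  have w1' : 1 - gk_w t != 0 by rewrite gt_eqF// subr_gt0.
  move: (Num.sqrt _) (gk_beta t) (gk_w t) r0 b0' w1' (expR _) (expR _).
  by move=> r b w r0 b0' w1' e1 e2; field; rewrite r0 b0' w1'.
rewrite -expRD; congr (_ * expR _).
rewrite (_ : 2 * (gk_beta t * x) * (gk_beta t * y) = 2 * gk_beta t ^+ 2 * x * y);
  last by ring.
rewrite uE wE !exprMn b2 (_ : t ^+ 4 = (t ^+ 2) ^+ 2); last by rewrite -exprM.
rewrite t2; field; apply/and3P; split => //; rewrite gt_eqF//.
  by nra.
rewrite (_ : _ - _ = 8 * s * (s ^+ 2 + 1)); last by ring.
by rewrite mulr_gt0 ?ltr_wpDl ?sqr_ge0// mulr_gt0//; lra.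
Qed.
End eigenfunction.

(** * The eigenfunctions in several variables *)

Section eigenfunctions_rV.
Variables (R : realType) (d : nat) (theta : 'I_d -> R).
Hypothesis theta_gt0 : forall k, 0 < theta k.
Local Notation I := {ffun 'I_d -> nat}.
Implicit Types (a : I -> R) (x y : 'rV[R]_d) (Y C : R) (m : I).

Lemma gk_phiE m x : gk_phi theta m x = \prod_(k < d) gk_phi1 (theta k) (m k)
  (x 0 k).
Proof. by []. Qed.

Lemma gk_phi_dom Y : 0 <= Y -> exists2 b : I -> R, asummable b &
  forall m x, (forall k, `|x 0 k| <= Y) -> `|gk_phi theta m x| <= b m.
Proof.
move=> Y0; have [Cr hCr] := choice (fun k => gk_phi1_bound (theta_gt0 k) Y0).
pose g k n := (Cr k).1 * (Cr k).2 ^+ n.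
exists (fun m => \prod_(k < d) g k (m k)).
  apply: (@asummable_prod _ _ g (fun k => (Cr k).1 / (1 - (Cr k).2))) => k.
  have [C0 /andP[r0 r1] _] := hCr k; apply: sum_geometric_le => // [|n].
    by rewrite r0.
  by rewrite ger0_norm// mulr_ge0// exprn_ge0.
move=> m x xY; rewrite gk_phiE normr_prod; apply: ler_prod => k _.
by rewrite normr_ge0 /=; have [_ _] := hCr k; apply.
Qed.

Lemma gk_phi_summable x : asummable (gk_phi theta ^~ x).
Proof.
have Y0 : 0 <= \sum_(k < d) `|x 0 k| by rewrite sumr_ge0.
have [b sb hb] := gk_phi_dom Y0; apply: asummable_dom sb => m.
apply: le_trans (ler_norm _); apply: hb => k.
by rewrite (bigD1 k)//= lerDl sumr_ge0.
Qed.

Lemma continuous_gk_phi1 t n : continuous (gk_phi1 t n : R -> R).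
Proof.
rewrite (_ : gk_phi1 t n = fun x : R => expR (- (gk_u t * x ^+ 2)) *
    (gk_coef t n * hermite_poly n (gk_beta t * x))); last first.
  by apply/funext => x; exact: gk_phi1E.
move=> x; apply: cvgM.
  apply: continuous_comp; last exact: continuous_expR.
  by apply: cvgN; apply: cvgMl_tmp; exact: exprn_continuous.
apply: cvgMl_tmp; apply: (@continuous_comp _ _ _ ( *%R (gk_beta t))).
  by apply: cvgMl_tmp; exact: cvg_id.
apply: differentiable_continuous; apply/derivable1_diffP.
by have [] := is_derive_hermite_poly n (gk_beta t * x).
Qed.

Lemma continuous_gk_phi m : continuous (gk_phi theta m : 'rV[R]_d -> R).
Proof.
move=> x; rewrite (_ : gk_phi theta m = fun x =>
  \prod_(k < d) gk_phi1 (theta k) (m k) (x 0 k))//.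
apply: (@cvg_big R _ _ _ _ (@mul_continuous R) _ (nbhs x)) => k _.
apply: (@continuous_comp _ _ _ (fun x : 'rV[R]_d => x 0 k)).
  exact: coord_continuous.
exact: continuous_gk_phi1.
Qed.

Lemma gk_expansion_continuous a C f : (forall m, `|a m| <= C) ->
  gk_expansion theta a f -> continuous (f : 'rV[R]_d -> R).
Proof.
(* The added 1 makes the domination uniform on the unit ball around [x], as [tannery] along [nbhs x]
   requires. *)
move=> aC af x; pose Y := \sum_(k < d) `|x 0 k| + 1.
have Y0 : 0 <= Y by rewrite addr_ge0// sumr_ge0.
have [b sb hb] := gk_phi_dom Y0.
apply: (@tannery _ _ _ (nbhs x) _ (fun y m => a m * gk_phi theta m y)
    (fun m => a m * gk_phi theta m x) (fun m => `|C| * b m) f (f x)).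
- exact: (@asummableZ _ _ `|C| _ sb).
- have : nbhs x (ball x (1 : R)) by exact: nbhsx_ballx.
  apply: filterS => y [_ xy] m; rewrite normrM ler_pM//.
    exact: le_trans (aC m) (ler_norm _).
  apply: hb => k; have := xy 0 k; rewrite /ball /= => /ltW xyk.
  rewrite -[y 0 k](subrK (x 0 k)) (le_trans (ler_normD _ _))// /Y addrC lerD//.
    by rewrite (bigD1 k)//= lerDl sumr_ge0.
  by rewrite distrC.
- by move=> m; apply: cvgMl_tmp; exact: continuous_gk_phi.
- by apply: nearW => y; exact: af.
- exact: af.
Qed.

Lemma gk_kernel_sum x y :
  has_sum (fun m => gk_phi theta m x * gk_phi theta m y)
    (integral_gaussian_kernel theta x y).
Proof.
pose c k := (Num.sqrt (1 + 2 * theta k ^+ 2))^-1 *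
  expR (theta k ^+ 4 * (x 0 k + y 0 k) ^+ 2 / (1 + 2 * theta k ^+ 2) -
    theta k ^+ 2 * (x 0 k ^+ 2 + y 0 k ^+ 2)).
pose h (k : 'I_d) (z : R) : R := expR (- (theta k ^+ 2 * `|x 0 k - z| ^+ 2)) *
  expR (- (theta k ^+ 2 * `|z - y 0 k| ^+ 2)) * gauss_factor z.
have -> : integral_gaussian_kernel theta x y = \prod_(k < d) c k.
  rewrite /integral_gaussian_kernel /Rintegral.
  have gker0 u v : 0 <= gaussian_kernel theta u v by exact: expR_ge0.
  have gE u v : gaussian_kernel theta u v =
      \prod_(k < d) expR (- (theta k ^+ 2 * `|u 0 k - v 0 k| ^+ 2)).
    by rewrite /gaussian_kernel -sumrN expR_sum.
  have mexp (r : R) (v : R -> R) : measurable_fun setT v ->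
      measurable_fun setT (fun z => expR (- (r * `|v z| ^+ 2))).
    move=> mv; apply: measurableT_comp; first exact: measurable_expR.
    apply: measurableT_comp => //; apply: measurable_funM => //.
    by apply: measurable_funX; apply: measurableT_comp.
  have mfactor : measurable_fun setT (@gauss_factor R).
    apply: measurable_funM => //; apply: measurableT_comp;
      first exact: measurable_expR.
    by apply: measurableT_comp => //; exact: measurable_funX.
  have mh k : measurable_fun setT (h k).
    by apply: measurable_funM => //; apply: measurable_funM; apply: mexp;
      exact: measurable_funB.
  rewrite (@ge0_integral_density _ _ _ (lebesgue_measure_rV R d) (gauss_measure R d)
    (@gauss_density R d)).
  - have := @integral_lebesgue_rV_prod R d h c.
    rewrite (_ : (\int[_]_z _)%E = (\int[lebesgue_measure_rV R d]_z
        (\prod_(k < d) h k ((z : 'rV_d) 0 k))%:E)%E); last first.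
      apply: eq_integral => z _; rewrite -EFinM !gE gauss_densityE -!big_split /=.
      by [].
    move=> ->//.
    + by move=> k z; rewrite !mulr_ge0 ?expR_ge0 ?powR_ge0.
    + by move=> k; exact: gauss_convolution.
  - by move=> z; rewrite gauss_densityE prodr_ge0// => k _; exact: gauss_factor_ge0.
  - rewrite (_ : @gauss_density R d = fun z => \prod_(k < d) gauss_factor (z 0 k)).
      by apply: measurable_prod => k _; exact: (measurable_coord k mfactor).
    by apply/funext => z; exact: gauss_densityE.
  - by [].
  - by move=> z; rewrite lee_fin mulr_ge0.
  - apply/measurable_EFinP; under eq_fun do rewrite !gE; apply: measurable_funM.
      apply: measurable_prod => k _.
      apply: (measurable_coord (h := fun z =>
        expR (- (theta k ^+ 2 * `|x 0 k - z| ^+ 2)))).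
      by apply: mexp; exact: measurable_funB.
    apply: measurable_prod => k _.
    apply: (measurable_coord (h := fun z =>
      expR (- (theta k ^+ 2 * `|z - y 0 k| ^+ 2)))).
    by apply: mexp; exact: measurable_funB.
have Y0 : 0 <= \sum_(k < d) (`|x 0 k| + `|y 0 k|) by rewrite sumr_ge0// =>
  k _; rewrite addr_ge0.
have xY k : `|x 0 k| <= \sum_(k < d) (`|x 0 k| + `|y 0 k|).
  by rewrite (bigD1 k)//= -addrA lerDl addr_ge0// sumr_ge0// =>
    j _; rewrite addr_ge0.
have yY k : `|y 0 k| <= \sum_(k < d) (`|x 0 k| + `|y 0 k|).
  by rewrite (bigD1 k)//= addrAC lerDr addr_ge0// sumr_ge0// =>
    j _; rewrite addr_ge0.
have [Cr hCr] := choice (fun k => gk_phi1_bound (theta_gt0 k) Y0).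
(* The constants come from squaring the bound C r^n of each factor. *)
have := @has_sum_prod R d
  (fun k n => gk_phi1 (theta k) n (x 0 k) * gk_phi1 (theta k) n (y 0 k))
  (fun k => (Cr k).1 ^+ 2 / (1 - (Cr k).2 ^+ 2)) c.
under eq_fun do rewrite big_split /=.
apply.
- move=> k N; have [C0 /andP[r0 r1] hk] := hCr k.
  apply: (sum_geometric_le (g := fun n =>
    gk_phi1 (theta k) n (x 0 k) * gk_phi1 (theta k) n (y 0 k))).
  + by rewrite exprn_ge0//= expr_lt1.
  + by rewrite sqr_ge0.
  + move=> n; rewrite normrM exprAC !expr2.
    rewrite [leRHS](_ : _ = ((Cr k).1 * (Cr k).2 ^+ n) * ((Cr k).1 *
      (Cr k).2 ^+ n)); last by ring.
    by rewrite ler_pM ?hk.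
- by move=> k; exact: gk_mehler.
Qed.

Definition gk_update x (k : 'I_d) (z : R) : 'rV[R]_d :=
  \row_j (if j == k then z else x 0 j).

(** The conclusion is again a vanishing expansion with coefficients bounded by [C], so the lemma can
    be applied to one coordinate after another. *)
Lemma gk_fiber_sum a C : (forall m, `|a m| <= C) ->
  (forall x, has_sum (fun m => a m * gk_phi theta m x) 0) ->
  forall k n x, has_sum (fun m => (if m k == n then a m else 0) *
    gk_phi theta m x) 0.
Proof.
move=> aC a0 k n x; have t0 := theta_gt0 k; have b0 := gk_beta_gt0 (theta k).
pose rest m := \prod_(j < d | j != k) gk_phi1 (theta j) (m j) (x 0 j).
pose c m := a m * rest m * gk_coef (theta k) (m k).
pose E z := expR (- (gk_u (theta k) * z ^+ 2)).
have phiE m z : a m * gk_phi theta m (gk_update x k z) =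
    E z * (c m * hermite_poly (m k) (gk_beta (theta k) * z)).
  rewrite gk_phiE (bigD1 k)//= mxE eqxx gk_phi1E /c /rest /E.
  rewrite (eq_bigr (fun j => gk_phi1 (theta j) (m j) (x 0 j))); first by ring.
  by move=> j jk; rewrite mxE (negbTE jk).
have H0 z : has_sum (fun m => c m * hermite_poly (m k) z) 0.
  have := @has_sumZ _ _ (E (z / gk_beta (theta k)))^-1 _ _
    (a0 (gk_update x k (z / gk_beta (theta k)))).
  rewrite mulr0; apply: eq_has_sum => m.
  rewrite phiE mulKf ?gt_eqF ?expR_gt0//.
  by congr (_ * hermite_poly _ _); rewrite mulrC divfK// gt_eqF.
have sc : hermite_summable (fun m => m k) c.
  have [q [r [q1 r01 hr]]] := gk_coef_bound t0.
  exists q => //.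
  have Y0 : 0 <= \sum_(j < d) `|x 0 j| by rewrite sumr_ge0.
  have xY j : `|x 0 j| <= \sum_(j < d) `|x 0 j|.
    by rewrite (bigD1 j)//= lerDl sumr_ge0.
  have [Cr hCr] := choice (fun j => gk_phi1_bound (theta_gt0 j) Y0).
  pose A := (1 - gk_w (theta k)) * Num.sqrt (gk_beta (theta k)).
  (* Times q^(m_k) and the Hermite weight, [c m] is [a m] times a product family whose k-th factor
     has become geometric. *)
  pose g j i := if j == k then A * r ^+ i else gk_phi1 (theta j) i (x 0 j).
  have sg : asummable (fun m : I => \prod_(j < d) g j (m j)).
    apply: (@asummable_prod _ _ g (fun j => if j == k then `|A| / (1 - r) else
      (Cr j).1 / (1 - (Cr j).2))) => j.
    rewrite /g; case: ifP => _; last first.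
      have [C0 r0 hj] := hCr j.
      by apply: (sum_geometric_le (g := fun i => gk_phi1 (theta j) i (x 0 j))) => // i; exact: hj.
    apply: (sum_geometric_le (g := fun i => A * r ^+ i)) => // i.
    by rewrite normrM [leLHS]mulrC ger0_norm ?exprn_ge0 1?mulrC//; case/andP: r01.
  apply: asummable_dom (asummable_mull aC sg) => m.
  rewrite (bigD1 k)//= /g eqxx -hr /c /rest le_eqVlt; apply/orP; left; apply/eqP.
  congr `|_|; rewrite [in RHS](eq_bigr (fun j => gk_phi1 (theta j) (m j) (x 0 j))).
    by ring.
  by move=> j /negbTE ->.
have := hermite_fiber_sum sc H0 n (gk_beta (theta k) * x 0 k).
move=> /(@has_sumZ _ _ (E (x 0 k))); rewrite mulr0; apply: eq_has_sum => m.
case: ifP => _; last by rewrite mul0r mulr0.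
rewrite -phiE; congr (_ * gk_phi theta m _); apply/rowP => j; rewrite mxE.
by case: eqP => // ->.
Qed.

Lemma gk_phi_neq0 m : exists x, gk_phi theta m x != 0.
Proof.
have h k : exists z, gk_phi1 (theta k) (m k) z != 0.
  have [z hz] := hermite_poly_neq0 R (m k).
  have b0 := gk_beta_gt0 (theta k); have /andP[w0 w1] := gk_w_itv (theta_gt0 k).
  exists (z / gk_beta (theta k)); rewrite gk_phi1E.
  rewrite (_ : gk_beta _ * (z / _) = z); last by rewrite mulrC divfK// gt_eqF.
  apply: mulf_neq0; first by rewrite gt_eqF// expR_gt0.
  apply: mulf_neq0 => //; rewrite gt_eqF// /gk_coef divr_gt0//.
    by rewrite !mulr_gt0 ?exprn_gt0 ?subr_gt0 ?sqrtr_gt0.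
  by rewrite sqrtr_gt0 hermite_weight_gt0.
have [z hz] := choice h; exists (\row_k z k); rewrite gk_phiE;
  apply/prodf_neq0 => k _.
by rewrite mxE.
Qed.

Lemma gk_phi_free a C : (forall m, `|a m| <= C) ->
  (forall x, has_sum (fun m => a m * gk_phi theta m x) 0) -> forall m, a m = 0.
Proof.
move=> aC a0 m0; have C0 : 0 <= C by apply: le_trans (aC m0).
have step (s : seq 'I_d) x :
    has_sum (fun m => (if all (fun k => m k == m0 k) s then a m else 0) *
      gk_phi theta m x) 0.
  elim: s x => [|k s IH] x; first exact: a0.
  have bs m : `|if all (fun k => m k == m0 k) s then a m else 0| <= C.
    by case: ifP => _; rewrite ?normr0.
  have := @gk_fiber_sum _ C bs IH k (m0 k) x.
  by apply: eq_has_sum => m /=; case: (m k == m0 k).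
have [x hx] := gk_phi_neq0 m0.
have := step (enum 'I_d) x; rewrite (_ : (fun m => _) =
    (fun m => if m == m0 then a m * gk_phi theta m x else 0)); last first.
  apply/funext => m; have [->|mm0] := eqVneq m m0.
    by rewrite (_ : all _ _)//; apply/allP => k _; rewrite eqxx.
  case: ifP => [/allP h|_]; last by rewrite mul0r.
  case/eqP: mm0; apply/ffunP => k; apply/eqP; apply: h; exact: mem_enum.
move=> s0.
have := @has_sum_fset R _ [fset m0]%fset (fun m =>
  if m == m0 then a m * gk_phi theta m x else 0).
have out m : m \notin [fset m0]%fset -> (if m == m0 then a m *
  gk_phi theta m x else 0) = 0.
  by rewrite inE => /negbTE ->.
move=> /(_ out) s1; have /eqP := has_sum_uniq s0 s1.
by rewrite big_seq_fset1 eqxx eq_sym mulf_eq0 (negbTE hx) orbF => /eqP.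
Qed.

End eigenfunctions_rV.

(** * The spaces of the integral-Gaussian kernel *)

Section gk_RKBS.
Variables (R : realType) (d : nat) (theta : 'I_d -> R).
Hypothesis theta_gt0 : forall k, 0 < theta k.

Lemma gk_expansion_measurable (a : {ffun 'I_d -> nat} -> R) C (f : borel_rV R d
  -> R) :
  (forall m, `|a m| <= C) -> gk_expansion theta a f -> measurable_fun setT f.
Proof.
move=> aC af; apply: continuous_measurable_rV.
exact: (@gk_expansion_continuous R d theta theta_gt0 a C f aC af).
Qed.

Lemma Bp_two_sided (p : \bar R) : (1 <= p)%E ->
  exists (B : completeNormedModType R) (b : fun_space (borel_rV R d) B),
    is_Bp theta p b /\ two_sided_RKBS b (integral_gaussian_kernel theta).
Proof.
move=> p1; have sphi := gk_phi_summable theta_gt0.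
have iphi := gk_phi_free theta_gt0.
exists (lp_space {ffun 'I_d -> nat} p1).
exists (lp_fun_space (T := borel_rV R d) sphi iphi gk_expansion_measurable p1).
split; last first.
  by apply: lp_space_two_sided => x y; exact: gk_kernel_sum.
split; [exact: expand_range|move=> v a ha av].
exact: (expand_norm (T := borel_rV R d) (phi := gk_phi theta) iphi ha av).
Qed.

End gk_RKBS.

Theorem corollary4p14 (R : realType) (d : nat) (d_gt0 : (0 < d)%N)
    (theta : 'I_d -> R) (theta_gt0 : forall k, 0 < theta k) :
  [/\ exists (B : completeNormedModType R) (b : fun_space (borel_rV R d) B),
        is_Bp theta 1%E b /\
        right_sided_RKBS b (integral_gaussian_kernel theta),
      forall p : \bar R, (1 < p)%E ->
      exists (B : completeNormedModType R) (b : fun_space (borel_rV R d) B),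
        is_Bp theta p b /\
        two_sided_RKBS b (integral_gaussian_kernel theta) &
      forall p : \bar R, (1 <= p)%E ->
        Bp_set theta p `<=` [set f : 'rV[R]_d -> R | continuous f]].
Proof.
split=> [|p p1|p p1 f [a ha af]].
- have [B [b [bB bK]]] := Bp_two_sided theta_gt0 (lexx 1%E).
  by exists B, b; split=> //; exact: two_sided_right.
- exact: Bp_two_sided (ltW p1).
- have aC m : `|a m| <= lp_norm p a by exact: lp_le_term p1 (lp_le_norm p1 ha).
  exact: (@gk_expansion_continuous R d theta theta_gt0 a (lp_norm p a) f aC af).
Qed.
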